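(* Let $\Gamma$ be a strongly connected digraphon on an atomless probability space $(\Omega,\mu)$, with peripheral multiplicity $D$. Let $\Omega=P_0\sqcup P_1\sqcup\ldots\sqcup P_{D-1}$ be a partition into cyclic sets witnessing that $\Gamma$ is graphically $D$-periodic and such that for all $i,j\in\{0,\ldots,D-1\}$ and almost every $(x,y)\in P_i\times P_j$, the reachability sequence from $x$ to $y$ is eventually $D$-periodic with shift $j-i$. Suppose further that $v_L$ and $v_R$ are real left and right eigenfunctions of $\Gamma$ for the eigenvalue $\rho(\Gamma)$. Then the decomposition of the digraphon $\Gamma^D$ into strong components consists of an empty fragmented set and of the strong components $P_0,P_1,\ldots,P_{D-1}$. Further, for each $i\in\{0,1,\ldots,D-1\}$, the digraphon $(\Gamma^D)_{\restriction P_i\times P_i}$ is aperiodic, we have $\rho\big((\Gamma^D)_{\restriction P_i\times P_i}\big)=\frac{\rho(\Gamma)^D}{\mu(P_i)}$, and $(v_L)_{\restriction P_i}$ and $(v_R)_{\restriction P_i}$ are left and right eigenfunctions, respectively, of $(\Gamma^D)_{\restriction P_i\times P_i}$ for the eigenvalue $\rho\big((\Gamma^D)_{\restriction P_i\times P_i}\big)$.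
   Context: $\mathbb{N}=\{1,2,\ldots\}$. All subsets of $\Omega$ are measurable. A digraphon on $(\Omega,\mu)$ is a measurable function $\Gamma:\Omega^2\to[0,1]$. A set $X\subseteq\Omega$ of positive measure is strongly connected in $\Gamma$ if $\int_{A\times B}\Gamma>0$ for every partition $A\sqcup B=X$ with $\mu(A),\mu(B)>0$; $\Gamma$ is strongly connected if $\Omega$ is. $X$ is a strong component if it is strongly connected and no $Y\subseteq\Omega$ with $\mu(X\cap Y),\mu(Y\setminus X)>0$ is strongly connected; $X$ is fragmented if no positive-measure subset of it is strongly connected. The decomposition into strong components of a digraphon is the partition $\Omega=X_0\sqcup\bigsqcup_{i\in I}X_i$, unique modulo nullsets, with $I$ at most countable, $X_0$ empty or fragmented, and each $X_i$ ($i\in I$) a strong component. For $A\subseteq\Omega$ of positive measure, $\Gamma_{\restriction A\times A}$ is the restriction of $\Gamma$ to $A\times A$, viewed as a digraphon on the probability space $(A,\mu_A)$, $\mu_A(\cdot)=\mu(\cdot\cap A)/\mu(A)$. A digraphon $\Gamma$ on a probability space $(\Omega,\mu)$ induces the compact operator $T_\Gamma$ on complex $L^2(\Omega,\mu)$, $(T_\Gamma f)(x)=\int_\Omega f(y)\Gamma(y,x)\,d\mu(y)$; (left) eigenvalues/eigenfunctions of $\Gamma$ are those of $T_\Gamma$, and right eigenfunctions are the eigenfunctions of $T_{\Gamma^\top}$, $\Gamma^\top(x,y)=\Gamma(y,x)$. $\rho(\Gamma)$ is the supremum of moduli of eigenvalues ($0$ if none). The peripheral multiplicity is the number of eigenvalues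 of modulus $\rho(\Gamma)$. $\Gamma$ is graphically $d$-periodic if there is a partition $\Omega=P_0\sqcup\ldots\sqcup P_{d-1}$ (into ''cyclic sets'') such that (with $P_d=P_0$) for every $j=0,\ldots,d-1$, $\Gamma=0$ almost everywhere on $P_j\times(\Omega\setminus P_{j+1})$. $\Gamma$ is aperiodic if the only $d\in\mathbb{N}$ for which it is graphically $d$-periodic is $d=1$. Powers: $\Gamma^1=\Gamma$ and $\Gamma^k(x,y)=\int_{\Omega^{k-1}}\Gamma(x,x_2)\Gamma(x_2,x_3)\cdots\Gamma(x_k,y)\,d\mu^{k-1}(x_2,\ldots,x_k)$. The reachability sequence from $x$ to $y$ is $\{k\in\mathbb{N}:\Gamma^k(x,y)>0\}$. A set $S\subseteq\mathbb{N}$ is eventually $D$-periodic with shift $s\in\mathbb{Z}$ if $S-s\subseteq D\mathbb{Z}$ and for some $k\in\mathbb{N}$, $(S-s)\cap\{k,k+1,\ldots\}=D\mathbb{N}\cap\{k,k+1,\ldots\}$. *)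

(* Defs.v *)
From HB Require Import structures.
From mathcomp Require Import all_boot all_order all_algebra.
From mathcomp Require Import all_classical all_reals all_analysis.
From mathcomp Require Export complex.

Set Implicit Arguments.
Unset Strict Implicit.
Unset Printing Implicit Defensive.
Import Order.TTheory GRing.Theory Num.Theory.
Import numFieldNormedType.Exports.

Local Open Scope classical_set_scope.
Local Open Scope ring_scope.

Section measure_theoretic_notions.
Context (d : measure_display) (T : measurableType d) (R : realType).

Definition atomless (mu : probability T R) : Prop :=
  forall A : set T, measurable A -> (0 < mu A)%E ->
    exists2 B : set T, measurable B /\ B `<=` A & (0 < mu B < mu A)%E.

(* Parts of a partition are allowed to be empty. *)
Definition is_partition (I : Type) (A : set T) (X : I -> set T) : Prop :=
  [/\ forall i, measurable (X i), trivIset setT X & \bigcup_i X i = A].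

(* The probability space (A, mu_A), with mu_A(B) = mu (B `&` A) / mu A, is
   represented by the probability measure mu_A on the whole type T: mu_A gives
   no mass to the complement of A, hence functions on A modulo mu_A-nullsets are
   the same as functions on T modulo mu_A-nullsets.  The second argument of
   mnormalize is a default value, used only if A is a nullset. *)
Definition cond_prob (mu : probability T R) (A : set T) (mA : measurable A) :
    probability T R :=
  mnormalize (mrestr mu mA) mu.

End measure_theoretic_notions.

Section digraphons.
Context (d : measure_display) (T : measurableType d) (R : realType).
Implicit Types (mu : probability T R) (G : T * T -> R).

Definition is_digraphon G : Prop :=
  measurable_fun setT G /\ forall z, 0 <= G z <= 1.

Definition transpose G : T * T -> R := fun z => G (z.2, z.1).

Definition strongly_connected mu G (X : set T) : Prop :=
  [/\ measurable X, (0 < mu X)%E &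
    forall A B : set T, measurable A -> measurable B ->
      A `&` B = set0 -> A `|` B = X -> (0 < mu A)%E -> (0 < mu B)%E ->
      (0 < \int[(mu \x mu)%E]_(z in A `*` B) (G z)%:E)%E].

Definition strong_component mu G (X : set T) : Prop :=
  strongly_connected mu G X /\
  ~ exists Y : set T, [/\ measurable Y, (0 < mu (X `&` Y))%E,
      (0 < mu (Y `\` X))%E & strongly_connected mu G Y].

Definition fragmented mu G (X : set T) : Prop :=
  measurable X /\
  forall Y : set T, measurable Y -> Y `<=` X -> (0 < mu Y)%E ->
    ~ strongly_connected mu G Y.

(* None indexes the fragmented set. *)
Definition strong_decomposition mu G (I : Type) (X0 : set T) (X : I -> set T) :
    Prop :=
  [/\ countable [set: I],
      is_partition setT (fun o : option I => if o is Some i then X i else X0),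
      X0 = set0 \/ fragmented mu G X0 &
      forall i, strong_component mu G (X i)].

(* ordS j is j + 1 modulo n. *)
Definition cyclic_sets mu G (n : nat) (P : 'I_n -> set T) : Prop :=
  is_partition setT P /\
  forall j : 'I_n, \forall z \ae (mu \x mu)%E,
    (P j `*` ~` P (ordS j)) z -> G z = 0.

Definition graphically_periodic mu G (n : nat) : Prop :=
  exists P : 'I_n -> set T, cyclic_sets mu G P.

Definition aperiodic mu G : Prop :=
  forall n : nat, (0 < n)%N -> (graphically_periodic mu G n <-> n = 1%N).

(* G(x, s_1) G(s_1, s_2) ... G(s_m, y) for s = [:: s_1; ...; s_m]. *)
Fixpoint walk_weight G (x : T) (s : seq T) (y : T) : R :=
  if s is z :: s' then G (x, z) * walk_weight G z s' y else G (x, y).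

(* The integral of F over T^m, for the m-fold power of mu, as an iterated
   integral. *)
Fixpoint iter_integral mu (m : nat) (F : seq T -> R) : R :=
  if m is m'.+1 then
    \int[mu]_z iter_integral mu m' (fun s => F (z :: s))
  else F [::].

(* Meaningful for k > 0 only. *)
Definition dpower mu G (k : nat) : T * T -> R :=
  fun z => iter_integral mu k.-1 (fun s => walk_weight G z.1 s z.2).

Definition reachability mu G (x y : T) : set nat :=
  [set k | (0 < k)%N /\ 0 < dpower mu G k (x, y)].

End digraphons.

Definition eventually_periodic (S : set nat) (D : nat) (s : int) : Prop :=
  let S' : set int := [set n%:Z - s | n in S] in
  S' `<=` [set m : int | (D%:Z %| m)%Z] /\
  exists2 k : nat, (0 < k)%N &
    S' `&` [set m : int | k%:Z <= m] =
    [set (D * q)%N%:Z | q in [set q : nat | (0 < q)%N]] `&`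
      [set m : int | k%:Z <= m].

Section spectrum.
Context (d : measure_display) (T : measurableType d) (R : realType).
Implicit Types (mu : probability T R) (G : T * T -> R) (f : T -> R[i]).

Definition complexL2 mu f : Prop :=
  (fun x => complex.Re (f x)) \in Lfun mu 2%:E /\
  (fun x => complex.Im (f x)) \in Lfun mu 2%:E.

Definition complex_integral mu f : R[i] :=
  Complex (\int[mu]_x complex.Re (f x)) (\int[mu]_x complex.Im (f x)).

Definition digraphon_op mu G f : T -> R[i] :=
  fun x => complex_integral mu (fun y => f y * (G (y, x))%:C%C).

Definition eigenfunction mu G (l : R[i]) f : Prop :=
  [/\ complexL2 mu f,
      ~ (\forall x \ae mu, f x = 0) &
      \forall x \ae mu, digraphon_op mu G f x = l * f x].

Definition eigenvalue mu G (l : R[i]) : Prop :=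
  exists f, eigenfunction mu G l f.

Definition modulus (l : R[i]) : R := complex.Re `|l|.

(* sup set0 = 0, as required when there is no eigenvalue. *)
Definition rho mu G : R := sup [set modulus l | l in eigenvalue mu G].

(* Eigenvalues are counted as elements of a set, that is, without repetition. *)
Definition peripheral_multiplicity mu G (D : nat) : Prop :=
  ([set l : R[i] | eigenvalue mu G l /\ modulus l = rho mu G] #= `I_D)%card.

Definition real_left_eigenfunction mu G (r : R) (v : T -> R) : Prop :=
  eigenfunction mu G r%:C%C (fun x => (v x)%:C%C).

Definition real_right_eigenfunction mu G (r : R) (v : T -> R) : Prop :=
  eigenfunction mu (transpose G) r%:C%C (fun x => (v x)%:C%C).

End spectrum.

(* Main.v *)
Require Import Defs.
From mathcomp Require Import all_boot all_order all_algebra.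
From mathcomp Require Import all_classical all_reals all_analysis.
From mathcomp Require Import measurable_realfun.
From mathcomp Require Import zify ring.

(** Everything happens at the level of the operators u |-> kernel_op mu K u,
    that is u |-> (y |-> \int u(x) K(x,y) dmu(x)), on real integrable functions.

    By Fubini's theorem the operator of the kernel power dpower mu G D is the
    D-th iterate of the operator of G (kernel_op_dpower), and likewise for the
    transposed kernels.  The cyclic structure is used through the relation
    [transfers mu K A B]: a function which vanishes on A is sent by K to a
    function which vanishes on B, i.e. B receives mass from A only.  Unlike
    vanishing of K on rectangles, this relation composes without a further
    appeal to Fubini.  Cyclicity makes G transfer P_j to P_(j+1), and makes the
    transpose of G transfer P_(j+1) to P_j.

    Strong components.  Suppose A and B are subsets of P_i such that infinitely
    many iterates of G^D send the indicator of A to a function vanishing on B.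
    Then G^(Dq)(x,y) = 0 for almost all (x,y) in A x B and infinitely many q,
    whereas G^(Dq)(x,y) > 0 for all large q by the reachability hypothesis; so A
    or B is a nullset (unreachable_null).  Four claims follow: no P_i is a
    nullset; P_i is strongly connected in G^D, since if no mass
    goes from A to the rest of P_i in one step, none does in any number of steps; nothing leaves P_i, so P_i is
    maximal; and G^D on P_i is aperiodic, since for a partition of P_i into
    n > 1 cyclic sets the iterates with exponent 1 modulo n never return to the
    set they start from.

    Eigenfunctions.  If v is an eigenfunction of G for r, then on P_i the D-th
    iterate only sees the restriction of v to P_i, so that this restriction
    satisfies the eigenvalue equation of G^D on P_i for r^D; passing from mu to
    the conditional probability on P_i divides by mu(P_i).  If v vanished on one
    P_i and r <> 0, it would vanish on every P_j, by following the cycle.  If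
    r = rho(G) = 0, then 0 is the only peripheral eigenvalue, so D = 1 and
    P_i is the whole space.

    Spectral radius.  The previous paragraph gives the inequality >=.  For <=,
    let f be an eigenfunction of G^D on P_i for l <> 0, extended by 0, and let w
    be a D-th root of its eigenvalue with respect to mu.  The geometric sum
    \sum_(k < D) w^(D-1-k) T^k f is annihilated by T - w because T^D f = w^D f,
    and it is not zero because on P_i all the terms with k > 0 vanish.  So w is
    an eigenvalue of G, of modulus at most rho(G) (eigenvalue_root).  That
    rho(G) bounds the eigenvalues at all requires the set of eigenvalues to be
    bounded, which a crude L^1 estimate shows (eigenvalue_bounded). *)

Set Implicit Arguments.
Unset Strict Implicit.
Unset Printing Implicit Defensive.
Import Order.TTheory GRing.Theory Num.Theory.
Import numFieldNormedType.Exports.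

Local Open Scope classical_set_scope.
Local Open Scope ring_scope.

(** * Kernels, their operators and their powers *)

Section kernels.
Context (d : measure_display) (T : measurableType d) (R : realType).
Implicit Types (mu : probability T R) (K L : T * T -> R) (u v : T -> R).

Definition kernel_op mu K u : T -> R := fun y => \int[mu]_x (u x * K (x, y)).

Definition kernel_comp mu K L : T * T -> R :=
  fun z => \int[mu]_w (K (z.1, w) * L (w, z.2)).

Lemma digraphon_transpose K : is_digraphon K -> is_digraphon (transpose K).
Proof.
case=> mK K01; split=> [|z]; last exact: K01.
by apply: (measurableT_comp mK); apply: measurable_fun_pair.
Qed.

Lemma measurable_digraphon_row K x : is_digraphon K ->
  measurable_fun setT (fun y => K (x, y)).
Proof. by case=> mK _; exact: measurableT_comp. Qed.

Lemma measurable_digraphon_col K y : is_digraphon K ->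
  measurable_fun setT (fun x => K (x, y)).
Proof. by case=> mK _; exact: measurableT_comp. Qed.

Lemma integrable_measurable mu u : mu.-integrable setT (EFin \o u) ->
  measurable_fun setT u.
Proof. by move=> iu; apply/measurable_EFinP; exact: measurable_int iu. Qed.

Lemma integrable_mul_unit mu u (k : T -> R) :
  mu.-integrable setT (EFin \o u) -> measurable_fun setT k ->
  (forall x, 0 <= k x <= 1) ->
  mu.-integrable setT (EFin \o (fun x => u x * k x)).
Proof.
move=> iu mk k01; apply: (le_integrable _ _ _ iu) => //.
  by apply/measurable_EFinP; apply: measurable_funM => //; exact: integrable_measurable iu.
move=> x _ /=; rewrite lee_fin normrM ler_piMr//.
by have /andP[k0 k1] := k01 x; rewrite ger0_norm.
Qed.

Lemma integrable_bounded mu u (M : R) : measurable_fun setT u ->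
  (forall x, `|u x| <= M) -> mu.-integrable setT (EFin \o u).
Proof.
move=> mu' uM; apply: measurable_bounded_integrable => //.
  by rewrite (le_lt_trans (probability_le1 _ _))// ltry.
by exists M; split; [exact: num_real|move=> y My x _; exact: le_trans (uM x) (ltW My)].
Qed.

Lemma integrable_col mu K u y : is_digraphon K ->
  mu.-integrable setT (EFin \o u) ->
  mu.-integrable setT (EFin \o (fun x => u x * K (x, y))).
Proof.
move=> dK iu; apply: integrable_mul_unit => //; first exact: measurable_digraphon_col.
by move=> x; exact: dK.2.
Qed.

Lemma integrable_digraphon_row mu K x : is_digraphon K ->
  mu.-integrable setT (EFin \o (fun y => K (x, y))).
Proof.
move=> dK; apply: (@integrable_bounded _ _ 1); first exact: measurable_digraphon_row.
by move=> y; have /andP[k0 k1] := dK.2 (x, y); rewrite ger0_norm.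
Qed.

Lemma EFin_Rintegral mu u : mu.-integrable setT (EFin \o u) ->
  (\int[mu]_x u x)%:E = (\int[mu]_x (u x)%:E)%E.
Proof. by move=> iu; rewrite /Rintegral fineK// integrable_fin_num. Qed.

Lemma normr_kernel_op mu K u y : is_digraphon K ->
  mu.-integrable setT (EFin \o u) ->
  `|kernel_op mu K u y| <= \int[mu]_x `|u x|.
Proof.
move=> dK iu; apply: (le_trans (le_normr_Rintegral _ _)) => //.
  exact: integrable_col.
apply: le_Rintegral => //.
- by apply: integrable_norm; exact: integrable_col.
- exact: integrable_norm.
- move=> x _; rewrite normrM ler_piMr//.
  by have /andP[k0 k1] := dK.2 (x, y); rewrite ger0_norm.
Qed.

Lemma integrable_fst_mul mu u (f : T * T -> R) :
  mu.-integrable setT (EFin \o u) -> measurable_fun setT f ->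
  (forall z, 0 <= f z <= 1) ->
  (mu \x mu)%E.-integrable setT (EFin \o (fun z => u z.1 * f z)).
Proof.
move=> iu mf f01; have mu' := integrable_measurable iu.
apply/integrable12ltyP.
  by apply/measurable_EFinP; apply: measurable_funM => //; exact: measurableT_comp.
have [_] := integrableP _ _ _ iu; apply: le_lt_trans.
apply: ge0_le_integral => //.
- by move=> x _; exact: integral_ge0.
- apply: (measurable_fun_fubini_tonelli_F (abse \o (EFin \o (fun z => u z.1 * f z)))) => //.
  apply: measurableT_comp => //; apply/measurable_EFinP.
  by apply: measurable_funM => //; exact: measurableT_comp.
  by move=> z; exact: abse_ge0.
- exact: measurable_int (integrable_abse iu).
move=> x _.
apply: (@le_trans _ _ (\int[mu]_y `|u x|%:E)%E).
  apply: ge0_le_integral => //.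
    apply: measurableT_comp => //; apply/measurable_EFinP.
    apply: measurable_funM; first exact: (measurable_cst (u x)).
    exact: (measurable_digraphon_row x (conj mf f01)).
  move=> y _ /=; rewrite lee_fin normrM ler_piMr//.
  by have /andP[k0 k1] := f01 (x, y); rewrite ger0_norm.
by rewrite integral_cst; [rewrite [X in (_ * X)%E](@probability_setT _ _ _ mu) mule1|].
Qed.

Lemma measurable_kernel_op mu K u : is_digraphon K ->
  mu.-integrable setT (EFin \o u) -> measurable_fun setT (kernel_op mu K u).
Proof.
move=> dK iu; apply/measurable_EFinP.
have := measurable_fubini_G (integrable_fst_mul iu dK.1 dK.2).
congr measurable_fun; apply/funext => y /=.
by rewrite /kernel_op EFin_Rintegral//; exact: integrable_col.
Qed.

Lemma integrable_kernel_op mu K u : is_digraphon K ->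
  mu.-integrable setT (EFin \o u) ->
  mu.-integrable setT (EFin \o kernel_op mu K u).
Proof.
move=> dK iu; apply: integrable_bounded; first exact: measurable_kernel_op.
by move=> x; exact: normr_kernel_op.
Qed.

Lemma kernel_opD mu K u v : is_digraphon K ->
  mu.-integrable setT (EFin \o u) -> mu.-integrable setT (EFin \o v) ->
  kernel_op mu K (u \+ v) = kernel_op mu K u \+ kernel_op mu K v.
Proof.
move=> dK iu iv; apply/funext => y; rewrite /kernel_op /= -RintegralD//.
- by apply: eq_Rintegral => x _; rewrite /= mulrDl.
- exact: integrable_col.
- exact: integrable_col.
Qed.

Lemma kernel_opZ mu K u a : is_digraphon K ->
  mu.-integrable setT (EFin \o u) ->
  kernel_op mu K (fun x => a * u x) = (fun y => a * kernel_op mu K u y).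
Proof.
move=> dK iu; apply/funext => y; rewrite /kernel_op -RintegralZl//.
- by apply: eq_Rintegral => x _; rewrite mulrA.
- exact: integrable_col.
Qed.

(** The iterated integrals may be exchanged because |u(x) K(x,w) L(w,y)| is at
    most |u(x)| and mu is finite. *)
Lemma Fubini_kernel mu K L u y : is_digraphon K -> is_digraphon L ->
  mu.-integrable setT (EFin \o u) ->
  \int[mu]_x (u x * \int[mu]_w (K (x, w) * L (w, y))) =
  \int[mu]_w (\int[mu]_x (u x * K (x, w)) * L (w, y)).
Proof.
move=> dK dL iu; apply: EFin_inj.
pose f z := K z * L (z.2, y).
have mf : measurable_fun setT f.
  apply: measurable_funM; first exact: dK.1.
  apply: (@measurableT_comp _ _ _ _ _ _ (fun w => L (w, y)))=> //.
  exact: measurable_digraphon_col.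
have f01 z : 0 <= f z <= 1.
  have /andP[? ?] := dK.2 z; have /andP[? ?] := dL.2 (z.2, y).
  by rewrite mulr_ge0// mulr_ile1.
have iF := integrable_fst_mul iu mf f01.
transitivity (\int[mu]_x \int[mu]_w (u x * f (x, w))%:E)%E.
  have ix x : mu.-integrable setT (EFin \o (fun w => K (x, w) * L (w, y))).
    apply: (integrable_mul_unit (integrable_digraphon_row _ x dK)).
      exact: measurable_digraphon_col.
    by move=> w; exact: dL.2.
  have E x : (u x * \int[mu]_w (K (x, w) * L (w, y)))%:E =
      (\int[mu]_w (u x * f (x, w))%:E)%E.
    rewrite -RintegralZl// EFin_Rintegral//.
    exact: (integrableZl measurableT (u x) (ix x)).
  rewrite EFin_Rintegral; first by apply: eq_integral => x _; exact: E.
  have := integrable_fubini_F iF.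
  by congr (_ .-integrable _ _); apply/funext => x /=; rewrite E.
rewrite [LHS](Fubini iF) EFin_Rintegral; last first.
  apply: (@integrable_col _ L (kernel_op mu K u) y dL).
  exact: integrable_kernel_op.
apply: eq_integral => w _; rewrite EFinM EFin_Rintegral; last exact: integrable_col.
rewrite -integralZr//; last exact: integrable_col.
by apply: eq_integral => x _; rewrite /f/= -EFinM mulrA.
Qed.

Lemma digraphon_comp mu K L : is_digraphon K -> is_digraphon L ->
  is_digraphon (kernel_comp mu K L).
Proof.
move=> dK dL; split.
  apply/measurable_EFinP.
  pose f (zw : (T * T) * T) := (K (zw.1.1, zw.2) * L (zw.2, zw.1.2))%:E.
  have mf : measurable_fun setT f.
    apply/measurable_EFinP; apply: measurable_funM.
      apply: (measurableT_comp dK.1); apply: measurable_fun_pair => //.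
      exact: (measurableT_comp measurable_fst).
    apply: (measurableT_comp dL.1); apply: measurable_fun_pair => //.
    exact: (measurableT_comp measurable_snd).
  have := @measurable_fun_fubini_tonelli_F _ _ _ _ _ mu f mf.
  move=> /(_ _)/(_ _)-/(_ _).
  rewrite (_ : fubini_F _ _ = EFin \o kernel_comp mu K L).
    apply=> -[[x y] w]; rewrite /f/= lee_fin mulr_ge0//.
      by have /andP[] := dK.2 (x, w).
    by have /andP[] := dL.2 (w, y).
  apply/funext => z; rewrite /fubini_F /kernel_comp/= EFin_Rintegral//.
  apply: (integrable_mul_unit (integrable_digraphon_row _ z.1 dK)).
    exact: measurable_digraphon_col.
  by move=> w; exact: dL.2.
move=> -[x y]; rewrite /kernel_comp/=; apply/andP; split.
  apply: Rintegral_ge0 => w _; apply: mulr_ge0.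
    by have /andP[] := dK.2 (x, w).
  by have /andP[] := dL.2 (w, y).
have -> : 1 = \int[mu]_w 1 :> R.
  by rewrite /Rintegral integral_cst// [X in (_ * X)%E](@probability_setT _ _ _ mu) mule1.
apply: le_Rintegral => //.
- apply: (integrable_mul_unit (integrable_digraphon_row _ x dK)).
    exact: measurable_digraphon_col.
  by move=> w; exact: dL.2.
- exact: finite_measure_integrable_cst.
- move=> w _.
  by have /andP[? ?] := dK.2 (x, w); have /andP[? ?] := dL.2 (w, y); rewrite mulr_ile1.
Qed.

Lemma kernel_op_comp mu K L u : is_digraphon K -> is_digraphon L ->
  mu.-integrable setT (EFin \o u) ->
  kernel_op mu (kernel_comp mu K L) u = kernel_op mu L (kernel_op mu K u).
Proof. by move=> dK dL iu; apply/funext => y; exact: Fubini_kernel. Qed.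

Lemma transpose_comp mu K L :
  transpose (kernel_comp mu K L) = kernel_comp mu (transpose L) (transpose K).
Proof.
by apply/funext => -[x y]; apply: eq_Rintegral => w _; rewrite mulrC.
Qed.

Lemma dpower1 mu K : dpower mu K 1 = K.
Proof. by apply/funext => -[]. Qed.

(** The two claims are proved together: taking the first factor K(x,w) out of
    the iterated integral requires the remaining power to be integrable. *)
Lemma dpowerS_digraphon mu K n : is_digraphon K ->
  is_digraphon (dpower mu K n.+1) /\
  dpower mu K n.+2 = kernel_comp mu K (dpower mu K n.+1).
Proof.
move=> dK.
(* The constant c stands for the product of the factors met before. *)
suff [H dH] : (forall (x y : T) c, iter_integral mu n (fun s => c * walk_weight K x s y)
    = c * dpower mu K n.+1 (x, y)) /\ is_digraphon (dpower mu K n.+1).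
  split=> //; apply/funext => -[x y]; rewrite {1}/dpower/=.
  by apply: eq_Rintegral => w _; rewrite H.
elim: n => [|n [IH dn]].
  by rewrite dpower1; split.
have E : dpower mu K n.+2 = kernel_comp mu K (dpower mu K n.+1).
  apply/funext => -[x y]; rewrite {1}/dpower/=.
  by apply: eq_Rintegral => w _; rewrite IH.
split; last by rewrite E; exact: digraphon_comp.
move=> x y c; rewrite E /kernel_comp/= -RintegralZl//.
  apply: eq_Rintegral => w _.
  transitivity (iter_integral mu n (fun s => (c * K (x, w)) * walk_weight K w s y)).
    by congr iter_integral; apply/funext => s; rewrite mulrA.
  by rewrite IH mulrA.
apply: (integrable_mul_unit (integrable_digraphon_row _ x dK)).
  exact: measurable_digraphon_col.
by move=> w; exact: dn.2.
Qed.

Lemma digraphon_dpower mu K n : (0 < n)%N -> is_digraphon K ->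
  is_digraphon (dpower mu K n).
Proof. by case: n => // n _ dK; have [] := @dpowerS_digraphon mu K n dK. Qed.

Lemma dpowerS mu K n : is_digraphon K ->
  dpower mu K n.+2 = kernel_comp mu K (dpower mu K n.+1).
Proof. by move=> dK; have [] := @dpowerS_digraphon mu K n dK. Qed.

Lemma integrable_iter_kernel_op mu K u n : is_digraphon K ->
  mu.-integrable setT (EFin \o u) ->
  mu.-integrable setT (EFin \o iter n (kernel_op mu K) u).
Proof.
by move=> dK iu; elim: n => //= n IH; exact: integrable_kernel_op.
Qed.

Lemma kernel_op_dpower mu K u n : (0 < n)%N -> is_digraphon K ->
  mu.-integrable setT (EFin \o u) ->
  kernel_op mu (dpower mu K n) u = iter n (kernel_op mu K) u.
Proof.
case: n => // n _ dK; elim: n u => [|n IH] u iu; first by rewrite dpower1.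
rewrite dpowerS// kernel_op_comp//; last exact: digraphon_dpower.
rewrite IH; first by rewrite [RHS]iterSr.
exact: integrable_kernel_op.
Qed.

(** Transposition reverses composition: the factor which dpower takes out first
    is applied last here. *)
Lemma kernel_op_transpose_dpower mu K u n : (0 < n)%N -> is_digraphon K ->
  mu.-integrable setT (EFin \o u) ->
  kernel_op mu (transpose (dpower mu K n)) u =
  iter n (kernel_op mu (transpose K)) u.
Proof.
case: n => // n _ dK; elim: n u => [|n IH] u iu; first by rewrite dpower1.
have dn := digraphon_dpower mu (ltn0Sn n) dK.
rewrite dpowerS// transpose_comp kernel_op_comp//; last 2 first.
- exact: digraphon_transpose.
- exact: digraphon_transpose.
by rewrite IH.
Qed.

Lemma iter_kernel_op_dpower mu K u n q : (0 < n)%N -> is_digraphon K ->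
  mu.-integrable setT (EFin \o u) ->
  iter q (kernel_op mu (dpower mu K n)) u = iter (n * q) (kernel_op mu K) u.
Proof.
move=> n0 dK iu; elim: q => [|q IH]; first by rewrite muln0.
rewrite iterS IH kernel_op_dpower//; last exact: integrable_iter_kernel_op.
by rewrite -iterD mulnS.
Qed.

End kernels.

(** * Almost everywhere statements and transfer of mass *)

Section almost_everywhere.
Context (d : measure_display) (T : measurableType d) (R : realType).
Implicit Types (mu : probability T R) (A B : set T) (Q : T * T -> Prop).

(** Almost every section of a nullset of the product is a nullset. *)
Lemma ae_prod_col mu Q : (\forall z \ae (mu \x mu)%E, Q z) ->
  \forall y \ae mu, \forall x \ae mu, Q (x, y).
Proof.
case=> N [mN N0 QN].
have : (\int[mu]_y (mu (ysection N y)) = 0)%E.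
  rewrite -N0; apply: esym.
  apply: (product_measure_unique (m' := (mu \x^ mu)%E)) => // A B mA mB.
  exact: product_measure2E.
have mS : measurable_fun setT (fun y => mu (ysection N y)).
  exact: measurable_fun_ysection.
under eq_integral do rewrite -(@gee0_abs _ (mu _))//.
move=> /(ae_eq_integral_abs _ measurableT mS); apply: filterS => y /= /(_ I) yN0.
exists (ysection N y); split => //; first exact: measurable_ysection.
move=> x /= nQ; rewrite /ysection/= inE; exact: QN.
Qed.

Lemma ae_prod_row mu Q : (\forall z \ae (mu \x mu)%E, Q z) ->
  \forall x \ae mu, \forall y \ae mu, Q (x, y).
Proof.
case=> N [mN N0 QN].
have : (\int[mu]_x (mu (xsection N x)) = 0)%E by exact: N0.
have mS : measurable_fun setT (fun x => mu (xsection N x)).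
  exact: measurable_fun_xsection.
under eq_integral do rewrite -(@gee0_abs _ (mu _))//.
move=> /(ae_eq_integral_abs _ measurableT mS); apply: filterS => x /= /(_ I) xN0.
exists (xsection N x); split => //; first exact: measurable_xsection.
move=> y /= nQ; rewrite /xsection/= inE; exact: QN.
Qed.

Lemma ae_notin_measure0 mu A : measurable A ->
  (\forall x \ae mu, ~ A x) -> mu A = 0.
Proof.
move=> mA [N [mN N0 AN]]; apply: (subset_measure0 _ _ _ N0) => // x Ax.
by apply: AN => /=; exact.
Qed.

Lemma measure0_ae_notin mu A : measurable A -> mu A = 0 ->
  \forall x \ae mu, ~ A x.
Proof. by move=> mA A0; exists A; split => // x /= /contrapT. Qed.

Lemma ae_forall_fin mu (I : finType) (Q : I -> T -> Prop) :
  (forall i, \forall x \ae mu, Q i x) -> \forall x \ae mu, forall i, Q i x.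
Proof. by move=> H; apply: filter_forall. Qed.

End almost_everywhere.

Section transfer.
Context (d : measure_display) (T : measurableType d) (R : realType).
Variable mu : probability T R.
Implicit Types (K L : T * T -> R) (u v : T -> R) (A B : set T).

Local Notation integrable u := (mu.-integrable [set: T] (EFin \o u)).

(** B receives mass from A only.  The relation is phrased on functions, rather
    than as the vanishing of K on a rectangle, so that it composes by mere
    iteration of the operator. *)
Definition transfers K A B : Prop :=
  forall u, integrable u -> (\forall x \ae mu, A x -> u x = 0) ->
    \forall y \ae mu, B y -> kernel_op mu K u y = 0.

Lemma Rintegral_ae0 u : measurable_fun setT u -> (\forall x \ae mu, u x = 0) ->
  \int[mu]_x u x = 0.
Proof.
move=> mu' u0; rewrite /Rintegral (ae_eq_integral (cst 0%E)) ?integral0//.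
  exact/measurable_EFinP.
by apply: filterS u0 => x -> _.
Qed.

Lemma transfersI K A B : is_digraphon K ->
  (\forall y \ae mu, B y -> \forall x \ae mu, ~ A x -> K (x, y) = 0) ->
  transfers K A B.
Proof.
move=> dK K0 u iu u0; apply: filterS K0 => y K0 By.
apply: Rintegral_ae0.
  exact: integrable_measurable (integrable_col y dK iu).
apply: filterS2 u0 (K0 By) => x u0 K0'.
have [Ax|nAx] := pselect (A x); first by rewrite u0// mul0r.
by rewrite K0'// mulr0.
Qed.

Lemma transfersT K : is_digraphon K -> transfers K setT setT.
Proof. by move=> dK; apply: transfersI => //; apply: aeW => y _; apply: aeW => x /(_ I). Qed.

Lemma integrable_indic1 A : measurable A -> integrable (\1_A : T -> R).
Proof.
move=> mA; apply: (@integrable_bounded _ _ _ _ _ 1) => // x.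
by rewrite indicE; case: (_ \in _); rewrite ?normr1 ?normr0.
Qed.

Lemma kernel_op_indic0 K A y : is_digraphon K -> measurable A ->
  kernel_op mu K \1_A y = 0 <-> \forall x \ae mu, A x -> K (x, y) = 0.
Proof.
move=> dK mA; have iK := integrable_col y dK (integrable_indic1 mA).
split; last first.
  move=> K0; apply: Rintegral_ae0; first exact: integrable_measurable iK.
  apply: filterS K0 => x K0; rewrite indicE; have [/set_mem/K0->|] := boolP (x \in A).
    by rewrite mulr0.
  by rewrite mul0r.
move=> K0; have : (\int[mu]_x `|(\1_A x * K (x, y))%:E| = 0)%E.
  rewrite -[RHS]/(0%:E) -K0 EFin_Rintegral//; apply: eq_integral => x _.
  by rewrite gee0_abs// lee_fin mulr_ge0//; have /andP[] := dK.2 (x, y).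
move=> /(ae_eq_integral_abs _ measurableT (measurable_int _ iK)).
apply: filterS => x /(_ I) /= [] + Ax.
by rewrite indicE mem_set// mul1r.
Qed.

(** A nonnegative kernel whose operator sends the indicator of A to a function
    vanishing on B is itself zero on A x B, and hence acts on B through ~A for
    every function, not only for that indicator. *)
Lemma transfers_indic K A B : is_digraphon K -> measurable A ->
  (\forall y \ae mu, B y -> kernel_op mu K \1_A y = 0) -> transfers K (~` A) B.
Proof.
move=> dK mA K0; apply: transfersI => //; apply: filterS K0 => y K0 By.
have /kernel_op_indic0 := K0 By; move=> /(_ dK mA); apply: filterS => x K0' /contrapT.
exact: K0'.
Qed.

Lemma transfers_ae_eq K A B u v : is_digraphon K -> transfers K A B ->
  integrable u -> integrable v ->
  (\forall x \ae mu, A x -> u x = v x) ->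
  \forall y \ae mu, B y -> kernel_op mu K u y = kernel_op mu K v y.
Proof.
move=> dK tK iu iv uv; pose w x := v x + (-1) * u x.
have iNu : integrable (fun x => -1 * u x) by exact: (integrableZl measurableT (-1) iu).
have iw : integrable w by exact: (integrableD measurableT iv iNu).
have : \forall y \ae mu, B y -> kernel_op mu K w y = 0.
  apply: tK => //; apply: filterS uv => x uv Ax; rewrite /w uv//.
  by rewrite mulN1r subrr.
apply: filterS => y H By; move: (H By).
rewrite (kernel_opD dK iv iNu) kernel_opZ//= mulN1r => /eqP.
by rewrite subr_eq0 => /eqP.
Qed.

Lemma iter_transfers K (A : nat -> set T) u v n : is_digraphon K ->
  (forall m, transfers K (A m) (A m.+1)) -> integrable u -> integrable v ->
  (\forall x \ae mu, A 0%N x -> u x = v x) ->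
  \forall y \ae mu, A n y ->
    iter n (kernel_op mu K) u y = iter n (kernel_op mu K) v y.
Proof.
move=> dK tK iu iv uv; elim: n => [//|n IH].
by apply: transfers_ae_eq IH => //; exact: integrable_iter_kernel_op.
Qed.

Lemma kernel_op0 K : kernel_op mu K (cst 0) = cst 0.
Proof.
by apply/funext => y; rewrite /kernel_op/= /Rintegral; under eq_integral do rewrite mul0r;
  rewrite integral0.
Qed.

Lemma iter_kernel_op0 K n : iter n (kernel_op mu K) (cst 0) = cst 0.
Proof. by elim: n => //= n ->; exact: kernel_op0. Qed.

Lemma integrable_cst0 : integrable (cst 0 : T -> R).
Proof. exact: finite_measure_integrable_cst. Qed.

Lemma iter_transfers0 K (A : nat -> set T) u n : is_digraphon K ->
  (forall m, transfers K (A m) (A m.+1)) -> integrable u ->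
  (\forall x \ae mu, A 0%N x -> u x = 0) ->
  \forall y \ae mu, A n y -> iter n (kernel_op mu K) u y = 0.
Proof.
move=> dK tK iu u0; have := iter_transfers n dK tK iu integrable_cst0 u0.
by apply: filterS => y H Any; rewrite H// iter_kernel_op0.
Qed.

Lemma integral_rectangle K A B : is_digraphon K -> measurable A -> measurable B ->
  (\int[(mu \x mu)%E]_(z in A `*` B) (K z)%:E =
   \int[mu]_(y in B) (kernel_op mu K \1_A y)%:E)%E.
Proof.
move=> dK mA mB; pose f z := \1_A z.1 * K z * \1_B z.2 : R.
have mf : measurable_fun setT f.
  apply: measurable_funM; first apply: measurable_funM;
    last exact: (measurableT_comp _ measurable_snd).
    exact: (measurableT_comp _ measurable_fst).
  exact: dK.1.
have f0 z : 0 <= f z by rewrite !mulr_ge0//; have /andP[] := dK.2 z.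
rewrite integral_mkcond [RHS]integral_mkcond.
transitivity (\int[(mu \x mu)%E]_z (f z)%:E)%E.
  apply: eq_integral => -[x y] _; rewrite patchE /f/= in_setX/= !indicE.
  by case: (_ \in _); case: (_ \in _); rewrite ?mul1r ?mul0r ?mulr1 ?mulr0.
rewrite fubini_tonelli2//; last exact/measurable_EFinP.
apply: eq_integral => y _; rewrite /fubini_G patchE /f/= indicE.
case: (y \in B) => /=; last by under eq_integral do rewrite mulr0; rewrite integral0.
rewrite EFin_Rintegral; last by apply: integrable_col => //; exact: integrable_indic1.
by apply: eq_integral => x _; rewrite mulr1.
Qed.

Lemma rectangle0P K A B : is_digraphon K -> measurable A -> measurable B ->
  (\int[(mu \x mu)%E]_(z in A `*` B) (K z)%:E = 0)%E <->
  \forall y \ae mu, B y -> kernel_op mu K \1_A y = 0.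
Proof.
move=> dK mA mB; rewrite integral_rectangle//.
have mK : measurable_fun setT (kernel_op mu K \1_A).
  by apply: measurable_kernel_op => //; exact: integrable_indic1.
have mKB : measurable_fun B (EFin \o kernel_op mu K \1_A).
  by apply/measurable_EFinP; exact: measurable_funTS.
rewrite (eq_integral (fun y => `|(kernel_op mu K \1_A y)%:E|%E)); last first.
  move=> y _; rewrite gee0_abs// lee_fin; apply: Rintegral_ge0 => x _.
  by rewrite mulr_ge0//; have /andP[] := dK.2 (x, y).
rewrite (ae_eq_integral_abs _ mB mKB); split; apply: filterS => y /= H By.
  by have [] := H By.
by rewrite H.
Qed.

End transfer.

(** * Cyclic families of sets *)

Section cyclic_families.
Context (d : measure_display) (T : measurableType d) (R : realType).
Variable mu : probability T R.
Local Notation integrable u := (mu.-integrable [set: T] (EFin \o u)).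

Lemma partition_cover (I : Type) (P : I -> set T) x :
  is_partition setT P -> exists i, P i x.
Proof. by case=> _ _ PT; have : setT x by []; rewrite -PT => -[i _ Pix]; exists i. Qed.

Lemma partition_inj (I : Type) (P : I -> set T) i j x :
  is_partition setT P -> P i x -> P j x -> i = j.
Proof. by case=> _ tP _ Pi Pj; apply: tP => //; exists x. Qed.

(** An index l other than s^k j is s^k l' for some l' other than j, as s^k is a
    permutation of a finite type; and u vanishes on P_l'. *)
Lemma iter_transfers_supp (G : T * T -> R) (I : finType) (P : I -> set T)
    (s : I -> I) (u : T -> R) (j : I) :
  is_digraphon G -> injective s -> (forall i, transfers mu G (P i) (P (s i))) ->
  integrable u -> (forall l, l != j -> \forall x \ae mu, P l x -> u x = 0) ->
  forall k l, l != iter k s j ->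
    \forall x \ae mu, P l x -> iter k (kernel_op mu G) u x = 0.
Proof.
move=> dG s_inj tP iu u0 k l lj.
have inj_k : injective (iter k s) by elim: k {lj} => //= k IH x y /s_inj/IH.
have [g _ gK] := injF_bij inj_k.
have gl : g l != j by apply: contra_neq lj => <-; rewrite gK.
have := @iter_transfers0 _ _ _ mu G (fun m => P (iter m s (g l))) u k dG.
by rewrite gK; apply => //; exact: u0.
Qed.

Lemma cyclic_transfers (G : T * T -> R) n (P : 'I_n -> set T) (j : 'I_n) :
  is_digraphon G -> cyclic_sets mu G P -> transfers mu G (P j) (P (ordS j)).
Proof.
move=> dG [pP cP]; apply: transfersI => //.
have := ae_forall_fin (fun l => ae_prod_col (cP l)).
apply: filterS => y H Pjy; apply: filterS (ae_forall_fin H) => x {}H nPjx.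
have [l Plx] := partition_cover x pP; apply: (H l); split => //= Ply.
by apply: nPjx; rewrite -(ordS_inj (partition_inj pP Ply Pjy)).
Qed.

Lemma cyclic_transfers_transpose (G : T * T -> R) n (P : 'I_n -> set T) (j : 'I_n) :
  is_digraphon G -> cyclic_sets mu G P ->
  transfers mu (transpose G) (P j) (P (ord_pred j)).
Proof.
move=> dG [pP cP]; apply: transfersI; first exact: digraphon_transpose.
apply: filterS (ae_prod_row (cP (ord_pred j))) => y H Py.
by apply: filterS H => x H nPx; apply: H; split => //=; rewrite ord_predK.
Qed.

End cyclic_families.

Section iterates_of_ordS.
Variable n : nat.
Implicit Types i j : 'I_n.

Lemma val_iter_ordS k i : iter k (@ordS n) i = ((i + k) %% n)%N :> nat.
Proof.
elim: k => [|k /= ->]; first by rewrite addn0 modn_small.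
by rewrite addnS -addn1 modnDml addn1.
Qed.

Lemma iter_ordS_id i : iter n (@ordS n) i = i.
Proof. by apply: val_inj; rewrite /= val_iter_ordS modnDr modn_small. Qed.

Lemma iter_ordS_neq k i : (0 < k < n)%N -> iter k (@ordS n) i != i.
Proof.
case/andP => k0 kn; rewrite -val_eqE/= val_iter_ordS.
apply/eqP => E; have /eqP : (i + k = i + 0 %[mod n])%N.
  by rewrite E addn0 (modn_small (ltn_ord i)).
by rewrite eqn_modDl mod0n modn_small// => /eqP k_eq0; rewrite k_eq0 in k0.
Qed.

Lemma iter_ordS_reach i j : exists k, iter k (@ordS n) i = j.
Proof.
exists (j + (n - i))%N; apply: val_inj; rewrite /= val_iter_ordS.
by rewrite addnCA subnKC 1?ltnW// modnDr modn_small.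
Qed.

(** Turns the facts on the orbits of ordS into facts on those of ord_pred, along
    which the transposed digraphon transfers mass. *)
Lemma iter_ord_predE k i j : iter k (@ord_pred n) j = i <-> iter k (@ordS n) i = j.
Proof.
have iterK (f g : 'I_n -> 'I_n) : cancel f g -> cancel (iter k f) (iter k g).
  by move=> fK; elim: k => // m IH x; rewrite [iter _ g _]iterSr iterS fK IH.
by split=> <-; apply: iterK; [exact: ord_predK|exact: ordSK].
Qed.

End iterates_of_ordS.

Section conditional_probability.
Context (d : measure_display) (T : measurableType d) (R : realType).
Variables (mu : probability T R) (P : set T) (mP : measurable P).
Hypothesis P0 : (0 < mu P)%E.

Let c := fine (mu P).

Lemma measure_fineK : mu P = c%:E.
Proof. by rewrite fineK// fin_num_measure. Qed.

Lemma fine_measure_gt0 : 0 < c.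
Proof. by rewrite -lte_fin -measure_fineK. Qed.

Lemma cond_probE A : cond_prob mu mP A = (mu (A `&` P) * c^-1%:E)%E.
Proof.
rewrite /cond_prob/= /mnormalize/= /mrestr setTI.
by rewrite gt_eqF//= lt_eqF// (le_lt_trans (probability_le1 _ _))// ltry.
Qed.

Lemma ae_cond_prob (Q : T -> Prop) :
  (\forall x \ae cond_prob mu mP, Q x) <-> \forall x \ae mu, P x -> Q x.
Proof.
split=> -[N [mN N0 QN]].
  exists (N `&` P); split; first exact: measurableI.
    apply/eqP; move: N0; rewrite cond_probE => /eqP.
    rewrite mule_eq0 => /orP[//|]; rewrite eqe invr_eq0.
    by rewrite gt_eqF// fine_measure_gt0.
  by move=> x /= /not_implyP[Px nQ]; split => //; exact: QN.
exists (N `|` ~` P); split.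
- by apply: measurableU => //; exact: measurableC.
- rewrite cond_probE setIUl setICl setU0.
  have -> : mu (N `&` P) = 0 by apply: (subset_measure0 _ _ _ N0) => //; exact: measurableI.
  by rewrite mul0e.
- move=> x /= nQ; have [Px|nPx] := pselect (P x); [left|by right].
  by apply: QN => /=; apply/not_implyP.
Qed.

End conditional_probability.

(** * Strong components of the power of a cyclic digraphon *)

Section cyclic_structure.
Context (d : measure_display) (T : measurableType d) (R : realType).
Variables (mu : probability T R) (G : T * T -> R) (D : nat) (P : 'I_D -> set T).
Hypothesis dG : is_digraphon G.
Hypothesis cyclicP : cyclic_sets mu G P.
Hypothesis reachP : forall i : 'I_D, \forall z \ae (mu \x mu)%E,
  (P i `*` P i) z -> eventually_periodic (reachability mu G z.1 z.2) D 0.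
Local Notation H := (dpower mu G D).
Local Notation integrable u := (mu.-integrable [set: T] (EFin \o u)).

Let mP i : measurable (P i). Proof. by have [[]] := cyclicP. Qed.

Let D_gt0 (i : 'I_D) : (0 < D)%N. Proof. exact: leq_ltn_trans (ltn_ord i). Qed.

Let dH (i : 'I_D) : is_digraphon H.
Proof. by apply: digraphon_dpower => //; exact: D_gt0 i. Qed.

Let tG i : transfers mu G (P i) (P (ordS i)). Proof. exact: cyclic_transfers. Qed.

Lemma eventually_periodic0_mul (S : set nat) : eventually_periodic S D 0 ->
  (0 < D)%N -> exists q0, forall q, (q0 <= q)%N -> S (D * q)%N.
Proof.
move=> [_ [k k0 E]] D0; exists k => q kq.
have kDq : (k <= D * q)%N by rewrite (leq_trans kq)// leq_pmull.
have : ([set (D * q)%N%:Z | q in [set q : nat | (0 < q)%N]] `&`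
      [set m : int | k%:Z <= m]) (D * q)%N%:Z.
  by split; [exists q => //=; exact: leq_trans kq|rewrite /= lez_nat].
by rewrite -E => -[[m Sm]]; rewrite subr0 => -[<-].
Qed.

Lemma positive_on_cyclic_set (i : 'I_D) :
  \forall y \ae mu, P i y -> \forall x \ae mu, P i x ->
    exists q0, forall q, (q0 <= q)%N -> 0 < dpower mu G (D * q) (x, y).
Proof.
apply: filterS (ae_prod_col (reachP i)) => y reach Piy.
apply: filterS reach => x reach Pix.
have [q0 Hq0] := eventually_periodic0_mul (reach (conj Pix Piy)) (D_gt0 i).
by exists q0 => q /Hq0 [].
Qed.

(** The contradiction on which all the structural claims rest: for almost every
    y in B and x in A, the entries G^(D (q n))(x,y) are zero for all n, but the
    entries G^(Dm)(x,y) are positive for all large m. *)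
Lemma unreachable_null i A B (q : nat -> nat) : measurable A -> measurable B ->
  A `<=` P i -> B `<=` P i -> (forall n, (n < q n)%N) ->
  (forall n, \forall y \ae mu, B y -> iter (q n) (kernel_op mu H) \1_A y = 0) ->
  (0 < mu A)%E -> mu B = 0.
Proof.
move=> mA mB AP BP q_gt AB0 A_gt0; apply: ae_notin_measure0 => //.
have D0 := D_gt0 i; have iA := integrable_indic1 mu mA.
have Z n : \forall y \ae mu, B y ->
    \forall x \ae mu, A x -> dpower mu G (D * q n) (x, y) = 0.
  have Dq0 : (0 < D * q n)%N by rewrite muln_gt0 D0 (leq_ltn_trans _ (q_gt n)).
  apply: filterS (AB0 n) => y H0 By.
  apply/kernel_op_indic0 => //; first exact: digraphon_dpower.
  by rewrite kernel_op_dpower// -iter_kernel_op_dpower// H0.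
apply: filterS2 (positive_on_cyclic_set i) (ae_foralln Z) => y pos {}Z By.
suff A0 : mu A = 0 by rewrite A0 ltxx in A_gt0.
apply: ae_notin_measure0 => //.
have Zx := ae_foralln (fun n => Z n By).
apply: filterS2 (pos (BP _ By)) Zx => x {}pos {}Zx Ax.
have [q0 /(_ (q q0) (ltnW (q_gt q0)))] := pos (AP _ Ax).
by rewrite Zx ?ltxx.
Qed.

(** If P_(i+1) were a nullset, all the mass of P_i would be lost after one step,
    and P_i would not be reachable from itself. *)
Lemma measure_cyclic_setS i : (0 < mu (P i))%E -> (0 < mu (P (ordS i)))%E.
Proof.
move=> Pi0; rewrite lt0e measure_ge0 andbT; apply/eqP => PSi0.
have iP := integrable_indic1 mu (mP i).
have op0 : \forall y \ae mu, kernel_op mu G \1_(P i) y = 0.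
  have : \forall y \ae mu, forall l, P l y -> kernel_op mu G \1_(P i) y = 0.
    apply: ae_forall_fin => l; have [->|lSi] := eqVneq l (ordS i).
      by apply: filterS (measure0_ae_notin (mP _) PSi0) => y nPy /nPy.
    apply: (@iter_transfers_supp _ _ _ mu G _ P (@ordS D) _ i _ _ _ _ _ 1%N l) => //.
      exact: ordS_inj.
    move=> m mi; apply: aeW => x Pmx; rewrite indicE memNset// => Pix.
    by move/eqP : mi; apply; apply: partition_inj Pmx Pix; case: cyclicP.
  apply: filterS => y Hy; have [l Ply] := partition_cover y cyclicP.1.
  exact: Hy Ply.
suff : mu (P i) = 0 by move=> P0; rewrite P0 ltxx in Pi0.
apply: (@unreachable_null i (P i) (P i) S) => // n.
rewrite iter_kernel_op_dpower//; last exact: D_gt0 i.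
have -> : (D * n.+1 = (D * n.+1).-1.+1)%N by rewrite prednK// muln_gt0 (D_gt0 i).
rewrite iterSr.
have := @iter_transfers0 _ _ _ mu G (fun=> setT) (kernel_op mu G \1_(P i))
  (D * n.+1).-1 dG (fun=> transfersT dG) (integrable_kernel_op dG iP).
have op0' : \forall x \ae mu, [set: T] x -> kernel_op mu G \1_(P i) x = 0.
  by apply: filterS op0 => x ->.
by move=> /(_ op0'); apply: filterS => y /(_ I).
Qed.

Lemma measure_cyclic_set_gt0 i : (0 < mu (P i))%E.
Proof.
have [j Pj] : exists j, (0 < mu (P j))%E.
  apply: contrapT => /forallNP P0.
  have : mu setT = 0.
    apply: ae_notin_measure0 => //.
    have : \forall x \ae mu, forall j, ~ P j x.
      apply: ae_forall_fin => j; apply: measure0_ae_notin => //.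
      by apply/eqP; move: (P0 j) => /negP; rewrite lt0e measure_ge0 andbT negbK.
    apply: filterS => x nPx _; have [j Pjx] := partition_cover x cyclicP.1.
    exact: nPx Pjx.
  by rewrite probability_setT => /eqP; rewrite onee_eq0.
have [k <-] := iter_ordS_reach j i; elim: k => //= k IH.
exact: measure_cyclic_setS.
Qed.

(** The power G^D sends mass from P_i to P_i only; transfers_power is the dual
    fact that the mass in P_i comes from P_i only. *)
Lemma transfers_power_cyclic (i : 'I_D) (u : T -> R) : integrable u ->
  (forall x, ~ P i x -> u x = 0) ->
  \forall y \ae mu, ~ P i y -> kernel_op mu H u y = 0.
Proof.
move=> iu u0.
have : \forall y \ae mu, forall l, l != i -> P l y -> kernel_op mu H u y = 0.
  apply: ae_forall_fin => l; have [->|li] := eqVneq l i; first exact: aeW.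
  rewrite kernel_op_dpower//; last exact: D_gt0 i.
  have := @iter_transfers_supp _ _ _ mu G _ P (@ordS D) u i dG (@ordS_inj D) (@tG) iu.
  move=> /(_ _ D l); rewrite iter_ordS_id => h.
  have {}h : \forall x \ae mu, P l x -> iter D (kernel_op mu G) u x = 0.
    apply: h => // m mi; apply: aeW => x Pmx; apply: u0 => Pix.
    by move/eqP : mi; apply; apply: partition_inj Pmx Pix; case: cyclicP.
  by apply: filterS h => y h _.
apply: filterS => y Hy nPy; have [l Ply] := partition_cover y cyclicP.1.
by apply: (Hy l) => //; apply/eqP => li; apply: nPy; rewrite -li.
Qed.

Lemma transfers_power i : transfers mu H (P i) (P i).
Proof.
move=> u iu u0; rewrite kernel_op_dpower//; last exact: D_gt0 i.
have := @iter_transfers0 _ _ _ mu G (fun m => P (iter m (@ordS D) i)) u D dG.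
rewrite iter_ordS_id => h; exact: h (fun m => @tG (iter m (@ordS D) i)) iu u0.
Qed.

Lemma cyclic_set_strongly_connected i : strongly_connected mu H (P i).
Proof.
split=> //; first exact: measure_cyclic_set_gt0.
move=> A B mA mB AB0 ABP A0 B0.
have AP : A `<=` P i by rewrite -ABP; exact: subsetUl.
have BP : B `<=` P i by rewrite -ABP; exact: subsetUr.
rewrite lt0e integral_ge0 ?andbT; last first.
  by move=> z _; rewrite lee_fin; have /andP[] := (dH i).2 z.
apply/eqP => /(rectangle0P mu (dH i) mA mB) AB.
suff : mu B = 0 by move=> B_eq0; rewrite B_eq0 ltxx in B0.
have iA := integrable_indic1 mu mA.
(* As no mass flows from A to B, and none leaves P_i, none leaves A: so A
   remains unable to reach B in any number of steps. *)
have tA : transfers mu H (~` A) (~` A).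
  apply: transfers_indic => //; first exact: dH i.
  have PA : \forall y \ae mu, ~ P i y -> kernel_op mu H \1_A y = 0.
    by apply: transfers_power_cyclic => // x nPx; rewrite indicE memNset// => /AP.
  apply: filterS2 AB PA => y Hy Hy' nAy; have [Py|/Hy'//] := pselect (P i y).
  by apply: Hy; move: Py; rewrite -ABP => -[].
apply: (@unreachable_null i A B S) => // n.
have := @iter_transfers0 _ _ _ mu H (fun=> ~` A) \1_A n.+1 (dH i) (fun=> tA) iA.
have A_off : \forall x \ae mu, (~` A) x -> \1_A x = 0 :> R.
  by apply: aeW => x nAx; rewrite indicE memNset.
move=> /(_ A_off); apply: filterS => y Hy By; apply: Hy => Ay.
by have : (A `&` B) y by []; rewrite AB0.
Qed.

Lemma cyclic_set_strong_component i : strong_component mu H (P i).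
Proof.
split; first exact: cyclic_set_strongly_connected.
move=> [Y [mY PY0 YP0 [_ _ Y_conn]]].
have mPY : measurable (P i `&` Y) by exact: measurableI.
have mYP : measurable (Y `\` P i) by exact: measurableD.
have disj : (P i `&` Y) `&` (Y `\` P i) = set0.
  by apply/seteqP; split=> // x [[Px _] [_ /(_ Px)]].
have cover : (P i `&` Y) `|` (Y `\` P i) = Y by rewrite setIC setUIDK.
have := Y_conn _ _ mPY mYP disj cover PY0 YP0.
rewrite (_ : integral _ _ _ = 0%E) ?ltxx//.
apply/(rectangle0P mu (dH i)) => //.
have : \forall y \ae mu, ~ P i y -> kernel_op mu H \1_(P i `&` Y) y = 0.
  apply: transfers_power_cyclic; first exact: integrable_indic1.
  by move=> x nPx; rewrite indicE memNset// => -[].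
by apply: filterS => y Hy [_ /Hy].
Qed.

Lemma cyclic_strong_decomposition : strong_decomposition mu H set0 P.
Proof.
have [[_ tP PT] _] := cyclicP.
split; [exact: countableP| |by left|exact: cyclic_set_strong_component].
split.
- by case=> [i|]; [exact: mP|exact: measurable0].
- move=> [i|] [j|] _ _ [x []]//= Pi Pj; congr Some.
  by apply: tP => //; exists x.
- apply/seteqP; split=> // x _; have : setT x by []; rewrite -PT => -[i _ Pix].
  by exists (Some i).
Qed.

End cyclic_structure.

(** * Aperiodicity *)

Section aperiodicity.
Context (d : measure_display) (T : measurableType d) (R : realType).
Variables (mu : probability T R) (G : T * T -> R) (D : nat) (P : 'I_D -> set T).
Hypothesis dG : is_digraphon G.
Hypothesis cyclicP : cyclic_sets mu G P.
Hypothesis reachP : forall i : 'I_D, \forall z \ae (mu \x mu)%E,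
  (P i `*` P i) z -> eventually_periodic (reachability mu G z.1 z.2) D 0.
Variables (i : 'I_D) (mPi : measurable (P i)).
Local Notation H := (dpower mu G D).
Local Notation GP := (H \_ (P i `*` P i)).
Local Notation muP := (cond_prob mu mPi).

Lemma graphically_periodic1 (nu : probability T R) (K : T * T -> R) :
  graphically_periodic nu K 1.
Proof.
exists (fun=> setT); split; last by move=> j; apply: aeW => z [_ /(_ I)].
split=> //; first by move=> j k _ _ _; rewrite (ord1 j) (ord1 k).
by apply/seteqP; split=> // x _; exists ord0.
Qed.

(** At the points of P_i in Q_(j+1), the image of u depends on u in P_i only, by
    transfers_power, and there only on u in Q_j.  The cyclic sets Q_j are
    given for the conditional probability, whereas the conclusion is about
    mu. *)
Lemma cyclic_refinement_transfers n (Q : 'I_n -> set T) (j : 'I_n) :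
  cyclic_sets muP GP Q -> transfers mu H (P i `&` Q j) (P i `&` Q (ordS j)).
Proof.
move=> [pQ cQ].
have D0 : (0 < D)%N by exact: leq_ltn_trans (ltn_ord i).
have dH : is_digraphon H by exact: digraphon_dpower.
have Pi0 : (0 < mu (P i))%E by exact: (measure_cyclic_set_gt0 dG cyclicP reachP).
have mCP : measurable (~` P i) by exact: measurableC.
apply: transfersI => //.
have outP : \forall y \ae mu, P i y -> \forall x \ae mu, (~` P i) x -> H (x, y) = 0.
  have C0 : \forall x \ae mu, P i x -> \1_(~` P i) x = 0 :> R.
    by apply: aeW => x Px; rewrite indicE memNset.
  have := transfers_power dG cyclicP (integrable_indic1 mu mCP) C0.
  by apply: filterS => y Hy /Hy/kernel_op_indic0; apply.
have inP : \forall y \ae mu, P i y -> \forall x \ae mu, P i x ->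
    forall l, (Q l `*` ~` Q (ordS l)) (x, y) -> GP (x, y) = 0.
  apply/(ae_cond_prob mPi Pi0).
  have := ae_forall_fin (fun l => ae_prod_col (cQ l)).
  apply: filterS => y Hy; apply/(ae_cond_prob mPi Pi0).
  exact: ae_forall_fin Hy.
apply: filterS2 outP inP => y outy iny [Py Qy].
apply: filterS2 (outy Py) (iny Py) => x outx inx nPQ.
have [Px|/outx//] := pselect (P i x).
have [l Qlx] := partition_cover x pQ.
have := inx Px l; rewrite patchE in_setX/= !mem_set//=; apply; split=> //= Qly.
apply: nPQ; split => //.
by rewrite -(ordS_inj (partition_inj pQ Qly Qy)).
Qed.

(** The pieces of P_i cut out by n > 1 cyclic sets are permuted without fixed
    point by the iterates of G^D whose exponent is 1 modulo n, so that a piece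
    would be unreachable from itself for infinitely many exponents. *)
Lemma aperiodic_cyclic_set : aperiodic muP GP.
Proof.
move=> n n0; split=> [[Q cQ]|->]; last exact: graphically_periodic1.
apply: contrapT => n1.
have {n0 n1} n_gt1 : (1 < n)%N by rewrite ltn_neqAle n0 andbT eq_sym; apply/eqP.
have pQ : is_partition setT Q by case: cQ.
have mPQ j : measurable (P i `&` Q j) by apply: measurableI => //; case: pQ.
have Pi0 : (0 < mu (P i))%E by exact: (measure_cyclic_set_gt0 dG cyclicP reachP).
have [j PQ0] : exists j, (0 < mu (P i `&` Q j))%E.
  apply: contrapT => /forallNP PQ0.
  suff P0 : mu (P i) = 0 by rewrite P0 ltxx in Pi0.
  apply: ae_notin_measure0 => //.
  have : \forall x \ae mu, forall j, ~ (P i `&` Q j) x.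
    apply: ae_forall_fin => j; apply: measure0_ae_notin => //.
    by apply/eqP; move: (PQ0 j) => /negP; rewrite lt0e measure_ge0 andbT negbK.
  by apply: filterS => x nPQ Px; have [j Qx] := partition_cover x pQ; apply: (nPQ j).
suff PQ_null : mu (P i `&` Q j) = 0 by rewrite PQ_null ltxx in PQ0.
have D0 : (0 < D)%N by exact: leq_ltn_trans (ltn_ord i).
have dH : is_digraphon H by exact: digraphon_dpower.
(* The exponents (n * m.+1).+1 are unbounded and equal to 1 modulo n. *)
have q_gt m : (m < (n * m.+1).+1)%N.
  by rewrite ltnS (leq_trans (leqnSn m))// leq_pmull// (leq_trans _ n_gt1).
apply: (unreachable_null dG reachP (mPQ j) (mPQ j) _ _ q_gt _ PQ0).
- exact: subIsetl.
- exact: subIsetl.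
move=> m.
have Sj : iter (n * m.+1).+1 (@ordS n) (ord_pred j) = j.
  rewrite iterSr ord_predK; apply: val_inj; rewrite /= val_iter_ordS.
  by rewrite addnC mulnC modnMDl modn_small.
have := @iter_transfers0 _ _ _ mu H (fun k => P i `&` Q (iter k (@ordS n) (ord_pred j)))
  \1_(P i `&` Q j) (n * m.+1).+1 dH (fun k => @cyclic_refinement_transfers n Q _ cQ)
  (integrable_indic1 mu (mPQ j)).
rewrite Sj; apply; apply: aeW => x /= [Px Qx]; rewrite indicE memNset// => -[_ Qjx].
have E := partition_inj pQ Qx Qjx.
have := @iter_ordS_neq n 1 (ord_pred j); rewrite /= ord_predK n_gt1 => /(_ isT).
by rewrite E eqxx.
Qed.

End aperiodicity.

(** * Integration against a conditional probability *)

Section conditional_integral.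
Context (d : measure_display) (T : measurableType d) (R : realType).
Variables (mu : probability T R) (P : set T) (mP : measurable P).
Hypothesis P0 : (0 < mu P)%E.
Local Notation muP := (cond_prob mu mP).
Let c := fine (mu P).
Let c_gt0 : 0 < c. Proof. exact: fine_measure_gt0. Qed.

(** mu is the sum of its restrictions to P and to ~P; the latter gives no mass to
    P, and the former none to ~P. *)
Lemma ge0_integral_mrestr (f : T -> \bar R) : measurable_fun setT f ->
  (forall x, 0 <= f x)%E ->
  (\int[mrestr mu mP]_x f x = \int[mu]_(x in P) f x)%E.
Proof.
move=> mf f0; have mC : measurable (~` P) by exact: measurableC.
have E : (\int[mu]_(x in P) f x =
    \int[measure_add (mrestr mu mP) (mrestr mu mC)]_(x in P) f x)%E.
  apply: eq_measure_integral => A mA AP; rewrite [RHS]measure_addE /= /mrestr.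
  rewrite (setIidl AP) -setDE (_ : A `\` P = set0) ?measure0 ?adde0//.
  by apply/seteqP; split=> // x [/AP].
rewrite E ge0_integral_measure_add//; last exact: measurable_funTS.
have CP0 : mrestr mu mC P = 0%E by rewrite /mrestr setICr measure0.
have PC0 : mrestr mu mP (~` P) = 0%E by rewrite /mrestr setICl measure0.
rewrite (@ge0_negligible_integral _ _ _ (mrestr mu mC) P P)//; last exact: measurable_funTS.
rewrite setDv integral_set0 adde0.
by rewrite (@ge0_negligible_integral _ _ _ (mrestr mu mP) setT (~` P))// setTD setCK.
Qed.

Lemma ge0_integral_cond_prob (f : T -> \bar R) : measurable_fun setT f ->
  (forall x, 0 <= f x)%E ->
  (\int[muP]_x f x = c^-1%:E * \int[mu]_(x in P) f x)%E.
Proof.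
move=> mf f0; have c_ge0 : 0 <= c^-1 by rewrite invr_ge0 ltW.
rewrite -ge0_integral_mrestr//.
rewrite -(@ge0_integral_mscale _ _ _ (mrestr mu mP) setT measurableT (NngNum c_ge0))//.
apply: eq_measure_integral => A mA _.
by rewrite [LHS](cond_probE mP P0) /mscale/= /mrestr muleC.
Qed.

Lemma Rintegral_cond_prob (f : T -> R) : measurable_fun setT f ->
  mu.-integrable setT (EFin \o (f \_ P)) ->
  \int[muP]_x f x = c^-1 * \int[mu]_x (f \_ P) x.
Proof.
move=> mf iP; have mfE : measurable_fun setT (EFin \o f) by exact/measurable_EFinP.
rewrite /Rintegral [in LHS]integralE.
rewrite ge0_integral_cond_prob//; last exact: measurable_funepos.
rewrite ge0_integral_cond_prob//; last exact: measurable_funeneg.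
rewrite -[X in fine (\int[mu]_x X x)]/(EFin \o (f \_ P)).
have EP : EFin \o (f \_ P) = (EFin \o f) \_ P.
  by apply/funext => x /=; rewrite !patchE; case: ifP.
rewrite EP in iP *; rewrite -integral_mkcond [in RHS]integralE.
have {}iP := (integrable_mkcond _ mP).2 iP.
have fp := integrable_pos_fin_num mP iP; have fn := integrable_neg_fin_num mP iP.
rewrite -muleBr//; last by apply: fin_num_adde_defl; rewrite fin_numN.
by rewrite fineM// fin_numB; apply/andP; split.
Qed.

Lemma Lfun2P (nu : probability T R) (f : T -> R) : f \in Lfun nu 2%:E <->
  measurable_fun setT f /\ (\int[nu]_x (f x ^+ 2)%:E < +oo)%E.
Proof.
split=> [f2|[mf foo]].
  split; first by move: f2; rewrite inE => /andP[] /[!inE].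
  have /integrableP[_] := Lfun2_integrable_sqr f2.
  by under eq_integral do rewrite gee0_abs ?lee_fin ?sqr_ge0//.
rewrite inE; apply/andP; split; rewrite inE//=.
rewrite /finite_norm unlock poweR_lty//=.
under eq_integral do rewrite powR_mulrn// real_normK ?num_real//.
exact: foo.
Qed.

Lemma Lfun2_cond_prob (f : T -> R) : measurable_fun setT f ->
  f \in Lfun muP 2%:E <-> f \_ P \in Lfun mu 2%:E.
Proof.
move=> mf.
have mf2 : measurable_fun setT (fun x => (f x ^+ 2)%:E).
  by apply/measurable_EFinP; exact: measurable_funX.
have E : (\int[mu]_x ((f \_ P) x ^+ 2)%:E = c%:E * \int[muP]_x (f x ^+ 2)%:E)%E.
  rewrite ge0_integral_cond_prob//; last by move=> x; rewrite lee_fin sqr_ge0.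
  rewrite muleA -EFinM divff ?gt_eqF// mul1e [RHS]integral_mkcond.
  apply: eq_integral => x _; rewrite !patchE; case: ifP => // _.
  by rewrite expr2 mulr0.
have mfP : measurable_fun setT (f \_ P).
  by apply/(measurable_restrictT _ mP); exact: measurable_funTS.
have I0 : (0 <= \int[muP]_x (f x ^+ 2)%:E)%E.
  by apply: integral_ge0 => x _; rewrite lee_fin sqr_ge0.
split=> /Lfun2P[_ foo]; apply/Lfun2P; split => //.
  by rewrite E lte_mul_pinfty// lee_fin ltW.
move: foo I0; rewrite E; case: (integral _ _ _) => [r _ _|+ _|//]; first exact: ltry.
by rewrite mulry gtr0_sg// mul1e ltxx.
Qed.

Lemma Lfun2_restrict (f : T -> R) : f \in Lfun mu 2%:E -> f \_ P \in Lfun mu 2%:E.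
Proof.
move=> /Lfun2P[mf foo]; apply/Lfun2P; split.
  by apply/(measurable_restrictT _ mP); exact: measurable_funTS.
apply: le_lt_trans foo; apply: ge0_le_integral => //.
- by move=> x _; rewrite lee_fin sqr_ge0.
- apply/measurable_EFinP; apply: measurable_funX.
  by apply/(measurable_restrictT _ mP); exact: measurable_funTS.
- by apply/measurable_EFinP; exact: measurable_funX.
- by move=> x _; rewrite lee_fin patchE; case: ifP => // _; rewrite expr0n sqr_ge0.
Qed.

Lemma Lfun2_integrable (nu : probability T R) (f : T -> R) :
  f \in Lfun nu 2%:E -> nu.-integrable setT (EFin \o f).
Proof.
by move=> f2; apply/Lfun1_integrable/Lfun_subset12 => //; exact: fin_num_measure.
Qed.

(** Normalizing mu on P divides the operator by mu(P): this is the origin of the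
    denominator in the spectral radius of the restriction. *)
Lemma kernel_op_cond_prob (K : T * T -> R) (f : T -> R) y : is_digraphon K ->
  measurable_fun setT f -> mu.-integrable setT (EFin \o (f \_ P)) ->
  kernel_op muP (K \_ (P `*` P)) f y =
  if y \in P then c^-1 * kernel_op mu K (f \_ P) y else 0.
Proof.
move=> dK mf iP.
have mPP : measurable (P `*` P) by exact: measurableX.
have mKP : measurable_fun setT (K \_ (P `*` P)).
  by apply/(measurable_restrictT _ mPP); apply: measurable_funTS; exact: dK.1.
have dKP : is_digraphon (K \_ (P `*` P)).
  split=> // z; rewrite patchE; case: ifP => _; first exact: dK.2.
  by rewrite lexx ler01.
have E : (fun x => f x * (K \_ (P `*` P)) (x, y)) \_ P =
    fun x => if y \in P then (f \_ P) x * K (x, y) else 0.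
  apply/funext => x; rewrite !patchE in_setX/=.
  by case: (x \in P); case: (y \in P); rewrite ?mulr0 ?mul0r.
rewrite /kernel_op Rintegral_cond_prob.
- rewrite E; case: (y \in P) => //.
  by rewrite /Rintegral (eq_integral (cst 0%E)) ?integral0 ?mulr0.
- by apply: measurable_funM => //; exact: (measurable_digraphon_col y dKP).
- rewrite E; case: (y \in P); first exact: integrable_col.
  exact: finite_measure_integrable_cst.
Qed.

End conditional_integral.

(** * Complex eigenfunctions *)

Section modulus_theory.
Variable R : realType.
Implicit Types (z w : R[i]).

Lemma modulusE z :
  modulus z = Num.sqrt (complex.Re z ^+ 2 + complex.Im z ^+ 2).
Proof. by rewrite /modulus normc_def. Qed.

Lemma modulus_normE z : (modulus z)%:C%C = `|z|.
Proof. by rewrite modulusE normc_def. Qed.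

Lemma modulus_ge0 z : 0 <= modulus z.
Proof. by rewrite modulusE sqrtr_ge0. Qed.

Lemma modulusM z w : modulus (z * w) = modulus z * modulus w.
Proof.
by apply: (@complexI R); rewrite rmorphM/= !modulus_normE normrM.
Qed.

Lemma modulusX z n : modulus (z ^+ n) = modulus z ^+ n.
Proof. by apply: (@complexI R); rewrite rmorphXn/= !modulus_normE normrX. Qed.

Lemma modulus_real (r : R) : modulus r%:C%C = `|r|.
Proof. by rewrite modulusE/= expr0n addr0 sqrtr_sqr. Qed.

Lemma ler_Re_modulus z : `|complex.Re z| <= modulus z.
Proof. by rewrite modulusE -sqrtr_sqr ler_wsqrtr// lerDl sqr_ge0. Qed.

Lemma ler_Im_modulus z : `|complex.Im z| <= modulus z.
Proof. by rewrite modulusE -sqrtr_sqr ler_wsqrtr// lerDr sqr_ge0. Qed.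

Lemma ler_modulus_ReIm z : modulus z <= `|complex.Re z| + `|complex.Im z|.
Proof.
rewrite modulusE -(@ler_pXn2r _ 2)// ?nnegrE ?addr_ge0// sqr_sqrtr; last first.
  by rewrite addr_ge0// sqr_ge0.
by rewrite sqrrD !real_normK ?num_real// addrAC lerDl mulrn_wge0// mulr_ge0.
Qed.

End modulus_theory.

Section complex_operator.
Context (d : measure_display) (T : measurableType d) (R : realType).
Variable mu : probability T R.
Implicit Types (K : T * T -> R) (f g : T -> R[i]) (u v w : T -> R).
Local Notation integrable u := (mu.-integrable [set: T] (EFin \o u)).

Definition cintegrable f :=
  integrable (fun x => complex.Re (f x)) /\ integrable (fun x => complex.Im (f x)).

Lemma complexL2_cintegrable f : complexL2 mu f -> cintegrable f.
Proof. by move=> [re im]; split; exact: Lfun2_integrable. Qed.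

Lemma digraphon_opE K f : digraphon_op mu K f =
  fun y => Complex (kernel_op mu K (fun x => complex.Re (f x)) y)
                   (kernel_op mu K (fun x => complex.Im (f x)) y).
Proof.
apply/funext => y; congr Complex; apply: eq_Rintegral => x _.
  by case: (f x) => a b /=; rewrite mulr0 subr0.
by case: (f x) => a b /=; rewrite mulr0 add0r.
Qed.

Lemma kernel_op_lin3 K (a b : R) u v w y : is_digraphon K ->
  integrable u -> integrable v -> integrable w ->
  kernel_op mu K (fun x => a * u x + b * v x + w x) y =
  a * kernel_op mu K u y + b * kernel_op mu K v y + kernel_op mu K w y.
Proof.
move=> dK iu iv iw.
have iau : integrable (fun x => a * u x) by exact: (integrableZl measurableT a iu).
have ibv : integrable (fun x => b * v x) by exact: (integrableZl measurableT b iv).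
have iab : integrable ((fun x => a * u x) \+ (fun x => b * v x)).
  exact: (integrableD measurableT iau ibv).
by rewrite (kernel_opD dK iab iw) (kernel_opD dK iau ibv)/= !kernel_opZ.
Qed.

Lemma digraphon_op_lin K (a : R[i]) f g y : is_digraphon K ->
  cintegrable f -> cintegrable g ->
  digraphon_op mu K (fun x => a * f x + g x) y =
  a * digraphon_op mu K f y + digraphon_op mu K g y.
Proof.
move=> dK [rf mf] [rg mg]; rewrite !digraphon_opE; case: a => a b.
apply/eqP; rewrite eq_complex/=; apply/andP; split; apply/eqP.
  rewrite -mulNr -kernel_op_lin3//; congr (kernel_op mu K _ y).
  by apply/funext => x; case: (f x) => p q; case: (g x) => p' q' /=; rewrite mulNr.
rewrite -kernel_op_lin3//; congr (kernel_op mu K _ y).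
by apply/funext => x; case: (f x) => p q; case: (g x) => p' q' /=.
Qed.

Lemma complexL2_lin (a : R[i]) f g : complexL2 mu f -> complexL2 mu g ->
  complexL2 mu (fun x => a * f x + g x).
Proof.
have p1 : (1 <= 2%:E :> \bar R)%E by rewrite lee_fin ler1n.
have [_ LD] := Lfun_addr_closed mu p1.
have LZ (r : R) u : u \in Lfun mu 2%:E -> (fun x => r * u x) \in Lfun mu 2%:E.
  move=> u2; rewrite (_ : (fun x => _) = r \o* u); last first.
    by apply/funext => x /=; rewrite mulrC.
  by apply: (@Lfun_scale _ _ _ mu u r 2) => //; rewrite ler1n.
move=> [rf mf] [rg mg]; case: a => a b; split.
  rewrite (_ : (fun x => _) = fun x =>
      a * complex.Re (f x) + (- b) * complex.Im (f x) + complex.Re (g x)).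
    exact: LD (LD _ _ (LZ a _ rf) (LZ (- b) _ mf)) rg.
  by apply/funext => x; case: (f x) => p q; case: (g x) => p' q' /=; rewrite mulNr.
rewrite (_ : (fun x => _) = fun x =>
    a * complex.Im (f x) + b * complex.Re (f x) + complex.Im (g x)).
  exact: LD (LD _ _ (LZ a _ mf) (LZ b _ rf)) mg.
by apply/funext => x; case: (f x) => p q; case: (g x) => p' q'.
Qed.

(** The image of an integrable function is even bounded, by its L^1 norm. *)
Lemma Lfun2_kernel_op K u : is_digraphon K -> integrable u ->
  kernel_op mu K u \in Lfun mu 2%:E.
Proof.
move=> dK iu; have mKu := measurable_kernel_op dK iu.
apply/Lfun2P; split=> //.
have : integrable (fun y => kernel_op mu K u y ^+ 2).
  apply: (@integrable_bounded _ _ _ _ _ ((\int[mu]_x `|u x|) ^+ 2)).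
    exact: measurable_funX.
  move=> y; rewrite normrX lerXn2r ?nnegrE//; last exact: normr_kernel_op.
  by apply: Rintegral_ge0 => x _.
move=> /integrableP[_]; under eq_integral do rewrite /= ger0_norm ?sqr_ge0//.
by [].
Qed.

Lemma complexL2_digraphon_op K f : is_digraphon K -> cintegrable f ->
  complexL2 mu (digraphon_op mu K f).
Proof. by move=> dK [re im]; rewrite digraphon_opE; split; exact: Lfun2_kernel_op. Qed.

Lemma iter_digraphon_opE K f n : iter n (digraphon_op mu K) f =
  fun y => Complex (iter n (kernel_op mu K) (fun x => complex.Re (f x)) y)
                   (iter n (kernel_op mu K) (fun x => complex.Im (f x)) y).
Proof.
elim: n => [|n IH]; first by apply/funext => y /=; case: (f y).
by rewrite iterS IH digraphon_opE.
Qed.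

Lemma complexL2_iter K f n : is_digraphon K -> complexL2 mu f ->
  complexL2 mu (iter n (digraphon_op mu K) f).
Proof.
move=> dK f2; elim: n => //= n IH.
by apply: complexL2_digraphon_op => //; exact: complexL2_cintegrable.
Qed.

Lemma real_eigenfunctionP K (r : R) v :
  eigenfunction mu K r%:C%C (fun x => (v x)%:C%C) <->
  [/\ v \in Lfun mu 2%:E, ~ (\forall x \ae mu, v x = 0) &
      \forall x \ae mu, kernel_op mu K v x = r * v x].
Proof.
have E x : digraphon_op mu K (fun x => (v x)%:C%C) x = (kernel_op mu K v x)%:C%C.
  by rewrite digraphon_opE/= (kernel_op0 mu K).
split=> [[[v2 _] v0 vE]|[v2 v0 vE]]; split.
- exact: v2.
- by apply: contra_not v0; apply: filterS => x ->.
- by apply: filterS vE => x; rewrite E -rmorphM => /complexI.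
- by split=> //; exact: Lfun_cst.
- by apply: contra_not v0; apply: filterS => x /complexI.
- by apply: filterS vE => x vE; rewrite E vE rmorphM.
Qed.

(** Measure f by N = |Re f| + |Im f|.  As K <= 1, the modulus of l f is at most
    the integral M of N almost everywhere, and integrating gives the claim.  The
    true bound is 1; the factor 2 comes from comparing N with the modulus. *)
Lemma eigenvalue_bounded K l : is_digraphon K -> Defs.eigenvalue mu K l -> modulus l <= 2.
Proof.
move=> dK [f [f2 f0 fE]]; have [re im] := complexL2_cintegrable f2.
pose u x := complex.Re (f x); pose v x := complex.Im (f x).
pose N x : R := `|u x| + `|v x|.
have iu : integrable (fun x => `|u x|) by exact: integrable_norm.
have iv : integrable (fun x => `|v x|) by exact: integrable_norm.
have iN : integrable N by exact: (integrableD measurableT iu iv).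
have N0 x : 0 <= N x by rewrite addr_ge0.
pose M := \int[mu]_x N x.
have M_gt0 : 0 < M.
  rewrite lt_neqAle Rintegral_ge0// andbT; apply/negP => /eqP M0; apply: f0.
  have : (\int[mu]_x `|(N x)%:E| = 0)%E.
    under eq_integral do rewrite gee0_abs ?lee_fin//.
    by rewrite -EFin_Rintegral// -/M -M0.
  move=> /(ae_eq_integral_abs _ measurableT (measurable_int _ iN)).
  apply: filterS => x /(_ I) [] /eqP.
  rewrite paddr_eq0// !normr_eq0 => /andP[/eqP ux /eqP vx].
  by apply/eqP; rewrite eq_complex/= -/(u x) -/(v x) ux vx eqxx.
have bound : \forall x \ae mu, modulus l * N x <= 2 * M.
  apply: filterS fE => x fE.
  have opM : modulus (l * f x) <= M.
    rewrite -fE digraphon_opE (le_trans (ler_modulus_ReIm _))//=.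
    by rewrite /M /N RintegralD// lerD// normr_kernel_op.
  apply: (@le_trans _ _ (2 * modulus (l * f x))); last by rewrite ler_pM2l.
  rewrite modulusM mulrCA ler_wpM2l ?modulus_ge0// mulr2n mulrDl mul1r.
  by rewrite lerD ?ler_Re_modulus ?ler_Im_modulus.
have : modulus l * M <= 2 * M; last by rewrite ler_pM2r.
rewrite -lee_fin /M EFinM EFin_Rintegral// -integralZl//.
have -> : (2 * \int[mu]_x N x)%:E = (\int[mu]_x (2 * M)%:E)%E.
  by rewrite integral_cst// [X in (_ * X)%E](@probability_setT _ _ _ mu) mule1.
apply: ae_ge0_le_integral => //.
- by move=> x _; rewrite lee_fin mulr_ge0// modulus_ge0.
- exact: measurable_int (integrableZl measurableT (modulus l) iN).
- by move=> x _; rewrite lee_fin mulr_ge0// ltW.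
- by apply: filterS bound => x Hx _; rewrite lee_fin.
Qed.

End complex_operator.

(** * Eigenvalues of the power and of its restrictions *)

Section roots_of_eigenvalues.
Context (d : measure_display) (T : measurableType d) (R : realType).
Variables (mu : probability T R) (G : T * T -> R).
Hypothesis dG : is_digraphon G.
Local Notation TG := (digraphon_op mu G).

(** The sum of the w^(n-1-k) T^k f for k < n, that is (T^n - w^n) / (T - w)
    applied to f. *)
Fixpoint geometric_sum (w : R[i]) (f : T -> R[i]) (n : nat) : T -> R[i] :=
  if n is n'.+1 then fun x => w * geometric_sum w f n' x + iter n' TG f x
  else fun=> 0.

Lemma complexL2_cst0 : complexL2 mu (fun=> 0).
Proof. by split; exact: Lfun_cst. Qed.

Lemma complexL2_geometric_sum w f n : complexL2 mu f ->
  complexL2 mu (geometric_sum w f n).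
Proof.
move=> f2; elim: n => [|n IH]; first exact: complexL2_cst0.
by apply: complexL2_lin => //; exact: complexL2_iter.
Qed.

(** The telescoping identity (T - w) S_n = T^n f - w^n f.  It holds at every
    point, since the operator is linear at every point. *)
Lemma digraphon_op_geometric_sum w f n y : complexL2 mu f ->
  TG (geometric_sum w f n) y =
  w * geometric_sum w f n y + (iter n TG f y - w ^+ n * f y).
Proof.
move=> f2; elim: n y => [|n IH] y.
  rewrite /= expr0 mul1r subrr mulr0 addr0 digraphon_opE/=.
  by rewrite !(kernel_op0 mu G).
rewrite digraphon_op_lin//; last 2 first.
- exact/complexL2_cintegrable/complexL2_geometric_sum.
- exact/complexL2_cintegrable/complexL2_iter.
rewrite IH /= exprS; ring.
Qed.

(** With w^D = l the geometric sum of length D is an eigenfunction of G for w.  It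
    is not zero: f lives on P_i, its images under 1, ..., D - 1 iterations live on
    the other cyclic sets, and so on P_i the sum equals w^(D-1) f. *)
Lemma eigenvalue_root (D : nat) (P : 'I_D -> set T) (i : 'I_D) f (l : R[i]) :
  cyclic_sets mu G P -> l != 0 ->
  eigenfunction mu (dpower mu G D) l f -> (forall x, ~ P i x -> f x = 0) ->
  exists2 w, w ^+ D = l & Defs.eigenvalue mu G w.
Proof.
move=> cP l0 [f2 f0 fE] fP; have D0 : (0 < D)%N by exact: leq_ltn_trans (ltn_ord i).
have wD : (D.-root l) ^+ D = l by exact: rootCK.
set w := D.-root l in wD; exists w => //.
have w0 : w != 0 by apply: contra_neq l0 => w0; rewrite -wD w0 expr0n gtn_eqF.
have [re im] := complexL2_cintegrable f2.
have iterD x : iter D TG f x = digraphon_op mu (dpower mu G D) f x.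
  by rewrite iter_digraphon_opE digraphon_opE !kernel_op_dpower.
exists (geometric_sum w f D); split.
- exact: complexL2_geometric_sum.
- have iter0 : \forall x \ae mu, forall k : 'I_D, (0 < k)%N -> P i x -> iter k TG f x = 0.
    apply: ae_forall_fin => k; case: (posnP k) => [->|k0]; first exact: aeW.
    have ik : i != iter k (@ordS D) i by rewrite eq_sym iter_ordS_neq// k0/=.
    have tG j : transfers mu G (P j) (P (ordS j)) by exact: cyclic_transfers.
    have f_off (h : R[i] -> R) : h 0 = 0 ->
        forall m, m != i -> \forall x \ae mu, P m x -> h (f x) = 0.
      move=> h0 m mi; apply: aeW => x Pmx; rewrite fP// => Pix.
      by move/eqP : mi; apply; apply: partition_inj Pmx Pix; case: cP.
    have := iter_transfers_supp dG (@ordS_inj D) (@tG) re (f_off (@complex.Re R) erefl) ik.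
    have := iter_transfers_supp dG (@ordS_inj D) (@tG) im (f_off (@complex.Im R) erefl) ik.
    apply: filterS2 => x I0 R0 _ Px; rewrite iter_digraphon_opE.
    by rewrite R0// I0.
  apply: contra_not f0; apply: filterS2 iter0 => x iter0.
  have [Px|/fP->//] := pselect (P i x).
  have sumE n : (0 < n <= D)%N -> geometric_sum w f n x = w ^+ n.-1 * f x.
    elim: n => [//|[|n] IH] /andP[_ nD].
      by rewrite /= mulr0 add0r expr0 mul1r.
    have := IH; rewrite /= => -> ; last exact: ltnW.
    by have := iter0 (Ordinal nD) isT Px; rewrite /= => ->; rewrite addr0 mulrA -exprS.
  rewrite sumE ?D0 ?leqnn//.
  by move/eqP; rewrite mulf_eq0 expf_eq0 (negPf w0) andbF => /eqP.
- apply: filterS fE => x fE.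
  by rewrite digraphon_op_geometric_sum// wD iterD fE subrr addr0.
Qed.

End roots_of_eigenvalues.

Section eigenfunctions_on_a_part.
Context (d : measure_display) (T : measurableType d) (R : realType).
Variables (mu : probability T R) (K : T * T -> R) (P : set T).
Hypotheses (dK : is_digraphon K) (mP : measurable P) (P0 : (0 < mu P)%E).
Local Notation muP := (cond_prob mu mP).
Local Notation KP := (K \_ (P `*` P)).
Let c := fine (mu P).
Let c_gt0 : 0 < c. Proof. exact: fine_measure_gt0. Qed.

Definition crestrict (f : T -> R[i]) x := if x \in P then f x else 0.

Lemma Re_crestrict f :
  (fun x => complex.Re (crestrict f x)) = (fun x => complex.Re (f x)) \_ P.
Proof. by apply/funext => x; rewrite patchE /crestrict; case: ifP. Qed.

Lemma Im_crestrict f :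
  (fun x => complex.Im (crestrict f x)) = (fun x => complex.Im (f x)) \_ P.
Proof. by apply/funext => x; rewrite patchE /crestrict; case: ifP. Qed.

(** The equation is required on P only: outside P both sides vanish, and the
    conditional probability ignores these points anyway. *)
Lemma real_eigenfunction_restrict (r : R) (v : T -> R) :
  v \in Lfun mu 2%:E -> ~ (\forall x \ae mu, P x -> v x = 0) ->
  (\forall x \ae mu, P x -> kernel_op mu K (v \_ P) x = r * v x) ->
  eigenfunction muP KP (r / c)%:C%C (fun x => ((v \_ P) x)%:C%C).
Proof.
move=> v2 v0 vE; have vP2 := Lfun2_restrict mP v2.
have vPP : (v \_ P) \_ P = v \_ P by apply/funext => x; rewrite !patchE; case: (x \in P).
have /Lfun2P[mvP _] := vP2.
apply/real_eigenfunctionP; split.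
- by apply/(Lfun2_cond_prob mP P0 mvP); rewrite vPP.
- apply: contra_not v0 => /(ae_cond_prob mP P0); apply: filterS => x vx Px.
  by move: (vx Px); rewrite patchE mem_set.
- apply/(ae_cond_prob mP P0); apply: filterS vE => x vE Px.
  rewrite kernel_op_cond_prob//; last by rewrite vPP; exact: Lfun2_integrable.
  by rewrite vPP mem_set// vE// patchE mem_set//; rewrite /c; ring.
Qed.

(** Conversely, an eigenfunction on P extended by 0 satisfies the eigenvalue
    equation outside P as well, provided that K sends no mass out of P. *)
Lemma eigenfunction_extend (l : R[i]) f :
  (forall u, mu.-integrable setT (EFin \o u) -> (forall x, ~ P x -> u x = 0) ->
     \forall y \ae mu, ~ P y -> kernel_op mu K u y = 0) ->
  eigenfunction muP KP l f -> eigenfunction mu K (c%:C%C * l) (crestrict f).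
Proof.
move=> off [[re im] f0 fE].
have /Lfun2P[mre _] := re; have /Lfun2P[mim _] := im.
have reP := (Lfun2_cond_prob mP P0 mre).1 re.
have imP := (Lfun2_cond_prob mP P0 mim).1 im.
have ireP := Lfun2_integrable reP; have iimP := Lfun2_integrable imP.
have offP (u : T -> R) x : ~ P x -> (u \_ P) x = 0 by move=> nPx; rewrite patchE memNset.
split.
- by split; rewrite ?Re_crestrict ?Im_crestrict.
- apply: contra_not f0 => f0; apply/(ae_cond_prob mP P0).
  by apply: filterS f0 => x + Px; rewrite /crestrict mem_set.
- rewrite digraphon_opE Re_crestrict Im_crestrict.
  have := (ae_cond_prob mP P0 _).1 fE; rewrite digraphon_opE.
  have := off _ iimP (offP _); have := off _ ireP (offP _).
  apply: filterS3 => x re0 im0 {}fE.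
  have [Px|nPx] := pselect (P x); last first.
    by rewrite re0// im0// /crestrict memNset// mulr0.
  rewrite /crestrict mem_set// -mulrA -fE//.
  rewrite !kernel_op_cond_prob// mem_set// -/c.
  apply/eqP; rewrite eq_complex/= !mul0r subr0 addr0.
  have c0 : c != 0 by rewrite gt_eqF.
  by rewrite !mulVKf// !eqxx.
Qed.

End eigenfunctions_on_a_part.

(** * Eigenfunctions along a cycle, and the theorem *)

Section eigenfunctions_along_cycles.
Context (d : measure_display) (T : measurableType d) (R : realType).
Variables (mu : probability T R) (K : T * T -> R) (I : finType) (P : I -> set T).
Variables (s : I -> I) (r : R) (v : T -> R).
Hypothesis dK : is_digraphon K.
Hypothesis mP : forall i, measurable (P i).
Hypothesis coverP : forall x, exists i, P i x.
Hypothesis tK : forall i, transfers mu K (P i) (P (s i)).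
Hypothesis v2 : v \in Lfun mu 2%:E.
Hypothesis vE : \forall x \ae mu, kernel_op mu K v x = r * v x.
Let iv := Lfun2_integrable v2.

Lemma iter_eigenfunction k :
  \forall x \ae mu, iter k (kernel_op mu K) v x = r ^+ k * v x.
Proof.
elim: k => [|k IH]; first by apply: aeW => x; rewrite mul1r.
have irv : mu.-integrable setT (EFin \o (fun x => r ^+ k * v x)).
  exact: (integrableZl measurableT (r ^+ k) iv).
have : \forall x \ae mu, [set: T] x -> iter k (kernel_op mu K) v x = r ^+ k * v x.
  by apply: filterS IH => x ->.
move=> /(transfers_ae_eq dK (transfersT dK) (integrable_iter_kernel_op k dK iv) irv).
apply: filterS2 vE => x vEx /(_ Logic.I).
by rewrite kernel_opZ// vEx iterS => ->; rewrite exprSr mulrA.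
Qed.

(** Following the cycle from P_i, the k-th iterate of v vanishes on the k-th next
    part, where it equals r^k v. *)
Lemma eigenfunction_nonzero_on_part i : r != 0 ->
  (forall j, exists k, iter k s i = j) -> ~ (\forall x \ae mu, v x = 0) ->
  ~ (\forall x \ae mu, P i x -> v x = 0).
Proof.
move=> r0 reach v0 vi0; apply: v0.
have : \forall x \ae mu, forall j, P j x -> v x = 0.
  apply: ae_forall_fin => j; have [k <-] := reach j.
  have := @iter_transfers0 _ _ _ mu K (fun m => P (iter m s i)) v k dK
    (fun m => @tK (iter m s i)) iv vi0.
  apply: filterS2 (iter_eigenfunction k) => x -> Hx /Hx/eqP.
  by rewrite mulf_eq0 expf_eq0 (negPf r0) andbF => /eqP.
by apply: filterS => x Hx; have [j /Hx] := coverP x.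
Qed.

(** On P_i, n iterations applied to the restriction of v or to v itself give the
    same result.  The kernel L is kept abstract because it will be the power of G
    for left eigenfunctions and its transpose for right ones. *)
Lemma restrict_eigenfunction n L i (P0 : (0 < mu (P i))%E) : is_digraphon L ->
  (forall u, mu.-integrable setT (EFin \o u) ->
     kernel_op mu L u = iter n (kernel_op mu K) u) ->
  iter n s i = i -> ~ (\forall x \ae mu, P i x -> v x = 0) ->
  eigenfunction (cond_prob mu (mP i)) (L \_ (P i `*` P i))
    (r ^+ n / fine (mu (P i)))%:C%C (fun x => ((v \_ (P i)) x)%:C%C).
Proof.
move=> dL LE ni v0; apply: real_eigenfunction_restrict => //.
have ivP : mu.-integrable setT (EFin \o (v \_ (P i))).
  by apply: Lfun2_integrable; exact: Lfun2_restrict.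
have vvP : \forall x \ae mu, P i x -> (v \_ (P i)) x = v x.
  by apply: aeW => x Px; rewrite patchE mem_set.
have := @iter_transfers _ _ _ mu K (fun m => P (iter m s i)) _ _ n dK
    (fun m => @tK (iter m s i)) ivP iv vvP.
rewrite LE// ni; apply: filterS2 (iter_eigenfunction n) => x E Hx /Hx ->.
exact: E.
Qed.

End eigenfunctions_along_cycles.

Section spectral_radius.
Context (d : measure_display) (T : measurableType d) (R : realType).
Variables (mu : probability T R) (G : T * T -> R).
Hypothesis dG : is_digraphon G.

Lemma modulus_le_rho l : Defs.eigenvalue mu G l -> modulus l <= rho mu G.
Proof.
move=> lG; apply: ub_le_sup; last by exists l.
by exists 2 => y [z zG <-]; exact: (eigenvalue_bounded dG zG).
Qed.

Lemma rho_ge0 : 0 <= rho mu G.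
Proof.
have [[l lG]|/forallNP noG] := pselect (exists l, Defs.eigenvalue mu G l).
  exact: le_trans (modulus_ge0 l) (modulus_le_rho lG).
rewrite /rho (_ : [set _ | _ in _] = set0) ?sup0//.
by apply/seteqP; split=> // y [l lG _]; case: (noG l).
Qed.

(** All the peripheral eigenvalues have modulus 0, so 0 is the only one. *)
Lemma peripheral_multiplicity_rho0 D : rho mu G = 0 -> Defs.eigenvalue mu G 0 ->
  peripheral_multiplicity mu G D -> D = 1%N.
Proof.
rewrite /peripheral_multiplicity => -> eig0.
rewrite (_ : [set l | _] = [set 0]); last first.
  apply/seteqP; split=> [l [_ l0]|_ ->] /=; last first.
    by split=> //; rewrite (_ : 0 = 0%:C%C)// modulus_real normr0.
  by apply/eqP; rewrite -normr_eq0 -modulus_normE l0.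
by move=> h; apply/esym/card_eq_II; rewrite -(card_eql (@card_set1 _ (0 : R[i]))).
Qed.

End spectral_radius.

Lemma transpose_restrict_square (d : measure_display) (T : measurableType d)
    (R : realType) (K : T * T -> R) (P : set T) :
  transpose (K \_ (P `*` P)) = (transpose K) \_ (P `*` P).
Proof.
by apply/funext => -[x y]; rewrite /transpose/= !patchE !in_setX/= andbC.
Qed.

Theorem proposition6p5 (R : realType) (d : measure_display)
  (T : measurableType d) (mu : probability T R) (mu_atomless : atomless mu)
  (G : T * T -> R) (digraphonG : is_digraphon G)
  (connectedG : strongly_connected mu G setT)
  (D : nat) (multD : peripheral_multiplicity mu G D)
  (P : 'I_D -> set T) (mP : forall i, measurable (P i))
  (cyclicP : cyclic_sets mu G P)
  (reachP : forall i j : 'I_D, \forall z \ae (mu \x mu)%E, (P i `*` P j) z ->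
     eventually_periodic (reachability mu G z.1 z.2) D (j%:Z - i%:Z))
  (vL vR : T -> R)
  (eigenL : real_left_eigenfunction mu G (rho mu G) vL)
  (eigenR : real_right_eigenfunction mu G (rho mu G) vR) :
  strong_decomposition mu (dpower mu G D) set0 P /\
  forall i : 'I_D,
    let muP := cond_prob mu (mP i) in
    let GP := dpower mu G D \_ (P i `*` P i) in
    [/\ aperiodic muP GP,
        rho muP GP = rho mu G ^+ D / fine (mu (P i)),
        real_left_eigenfunction muP GP (rho muP GP) (vL \_ (P i)) &
        real_right_eigenfunction muP GP (rho muP GP) (vR \_ (P i))].
Proof.
have reach0 i : \forall z \ae (mu \x mu)%E, (P i `*` P i) z ->
    eventually_periodic (reachability mu G z.1 z.2) D 0.
  by have := reachP i i; rewrite subrr.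
split; first exact: cyclic_strong_decomposition.
move=> i muP GP.
have D0 : (0 < D)%N by exact: leq_ltn_trans (ltn_ord i).
have dH : is_digraphon (dpower mu G D) by exact: digraphon_dpower.
have Pi0 : (0 < mu (P i))%E by exact: (measure_cyclic_set_gt0 digraphonG cyclicP reach0).
have c0 : 0 < fine (mu (P i)) by exact: fine_measure_gt0.
have r0 := rho_ge0 mu digraphonG.
have coverP x : exists j, P j x by apply: partition_cover; case: cyclicP.
have PiT : rho mu G = 0 -> P i = setT.
  move=> rho0; have D1 : D = 1%N.
    apply: peripheral_multiplicity_rho0 multD => //.
    by exists (fun x => (vL x)%:C%C); rewrite -[0]/(0%:C%C) -rho0.
  apply/seteqP; split=> // x _; have [j Pjx] := coverP x.
  suff -> : i = j by [].
  by apply: val_inj => /=; have := ltn_ord i; have := ltn_ord j; lia.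
(* When rho = 0 a zero of v does not propagate along the cycle, but then D = 1
   and there is nothing to propagate. *)
have nonzero (K : T * T -> R) (s : 'I_D -> 'I_D) v : is_digraphon K ->
    (forall j, transfers mu K (P j) (P (s j))) ->
    (forall j, exists k, iter k s i = j) ->
    v \in Lfun mu 2%:E -> ~ (\forall x \ae mu, v x = 0) ->
    (\forall x \ae mu, kernel_op mu K v x = rho mu G * v x) ->
    ~ (\forall x \ae mu, P i x -> v x = 0).
  move=> dK tK sK v2 v0 vE; have [/PiT PT|rho0] := eqVneq (rho mu G) 0.
    by rewrite PT => vi0; apply: v0; apply: filterS vi0 => x; apply.
  exact: (eigenfunction_nonzero_on_part dK coverP tK v2 vE rho0 sK v0).
have left : eigenfunction muP GP (rho mu G ^+ D / fine (mu (P i)))%:C%C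
    (fun x => ((vL \_ (P i)) x)%:C%C).
  have /real_eigenfunctionP[v2 v0 vE] := eigenL.
  have tG j : transfers mu G (P j) (P (ordS j)) by exact: cyclic_transfers.
  apply: (restrict_eigenfunction digraphonG mP (@tG) v2 vE Pi0) => //.
  - by move=> u iu; exact: kernel_op_dpower.
  - exact: iter_ordS_id.
  - by apply: (nonzero G (@ordS D)) => // j; exact: iter_ordS_reach.
have right : eigenfunction muP (transpose GP) (rho mu G ^+ D / fine (mu (P i)))%:C%C
    (fun x => ((vR \_ (P i)) x)%:C%C).
  have /real_eigenfunctionP[v2 v0 vE] := eigenR.
  have dT := digraphon_transpose digraphonG.
  have tG j : transfers mu (transpose G) (P j) (P (ord_pred j)).
    exact: cyclic_transfers_transpose.
  rewrite transpose_restrict_square.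
  apply: (restrict_eigenfunction dT mP (@tG) v2 vE Pi0) => //.
  - exact: digraphon_transpose.
  - by move=> u iu; exact: kernel_op_transpose_dpower.
  - by apply/iter_ord_predE; exact: iter_ordS_id.
  - apply: (nonzero (transpose G) (@ord_pred D)) => // j.
    by have [k kE] := iter_ordS_reach j i; exists k; apply/iter_ord_predE.
have rhoE : rho muP GP = rho mu G ^+ D / fine (mu (P i)).
  have M0 : 0 <= rho mu G ^+ D / fine (mu (P i)) by rewrite divr_ge0 ?exprn_ge0// ltW.
  have ub : ubound [set modulus l | l in Defs.eigenvalue muP GP]
      (rho mu G ^+ D / fine (mu (P i))).
    move=> y [l [f fE] <-]; have [->|l0] := eqVneq l 0.
      by rewrite (_ : 0 = 0%:C%C)// modulus_real normr0.
    rewrite ler_pdivlMr//.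
    have off u := transfers_power_cyclic digraphonG cyclicP (i := i) (u := u).
    have := eigenfunction_extend dH Pi0 off fE.
    move=> /(eigenvalue_root digraphonG (i := i) cyclicP) [||w wD wG].
    - by rewrite mulf_neq0// (_ : 0 = 0%:C%C)// (inj_eq (@complexI R)) gt_eqF.
    - by move=> x nPx; rewrite /crestrict memNset.
    have := modulus_le_rho digraphonG wG.
    rewrite -(@ler_pXn2r _ D)// ?nnegrE ?modulus_ge0// -modulusX wD modulusM.
    by rewrite modulus_real gtr0_norm// mulrC.
  have attained : [set modulus l | l in Defs.eigenvalue muP GP]
      (rho mu G ^+ D / fine (mu (P i))).
    exists (rho mu G ^+ D / fine (mu (P i)))%:C%C; first by eexists; exact: left.
    by rewrite modulus_real ger0_norm.
  apply/eqP; rewrite eq_le; apply/andP; split.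
    by apply: ge_sup => //; exists (rho mu G ^+ D / fine (mu (P i))).
  by apply: ub_le_sup => //; exists (rho mu G ^+ D / fine (mu (P i))).
split=> //.
- exact: (aperiodic_cyclic_set digraphonG cyclicP reach0).
- by rewrite /real_left_eigenfunction rhoE.
- by rewrite /real_right_eigenfunction rhoE.
Qed.
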